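(* Every hyperbolic group embeds into a torsion-saturated hyperbolic group.
   Context: In a hyperbolic group, every element $g$ of infinite order lies in a unique maximal virtually abelian subgroup $M(g)$. A group $G$ is torsion-saturated if (1) for every isomorphism $\alpha:F_1\to F_2$ between finite subgroups of $G$ there exists $g\in G$ with $gxg^{-1}=\alpha(x)$ for all $x\in F_1$; and (2) for every finite subgroup $F$ of $G$ there is an infinite set $\{g_1,g_2,\ldots\}\subset G$ of elements of infinite order with $M(g_n)=\langle g_n\rangle\times F$ for all $n$ and $M(g_n)\neq M(g_m)$ for $n\neq m$. *)

(* Defs.v *)
From Stdlib Require Import ZArith List.
Import ListNotations.

Record Grp := {
  car :> Type;
  gmul : car -> car -> car;
  gone : car;
  ginv : car -> car;
  gmulA : forall x y z, gmul x (gmul y z) = gmul (gmul x y) z;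
  gmul1 : forall x, gmul gone x = x;
  gmulV : forall x, gmul (ginv x) x = gone
}.

Arguments gmul {g}.
Arguments gone {g}.
Arguments ginv {g}.

Section GroupNotions.
Variable G : Grp.

Fixpoint gpow (x : G) (n : nat) : G :=
  match n with O => gone | S m => gmul x (gpow x m) end.

Definition zpow (x : G) (k : Z) : G :=
  if (0 <=? k)%Z then gpow x (Z.to_nat k) else ginv (gpow x (Z.to_nat (- k))).

Definition infinite_order (x : G) : Prop := forall n : nat, n <> O -> gpow x n <> gone.

Definition subgroup (H : G -> Prop) : Prop :=
  H gone /\ (forall x y, H x -> H y -> H (gmul x y)) /\ (forall x, H x -> H (ginv x)).

Definition finite_set (H : G -> Prop) : Prop := exists l : list G, forall x, H x <-> In x l.

Definition finite_subgroup (H : G -> Prop) : Prop := subgroup H /\ finite_set H.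

Definition subset (H K : G -> Prop) : Prop := forall x, H x -> K x.

Definition virtually_abelian (H : G -> Prop) : Prop :=
  subgroup H /\
  exists A : G -> Prop, subgroup A /\ subset A H /\
    (forall a b, A a -> A b -> gmul a b = gmul b a) /\
    exists reps : list G, (forall r, In r reps -> H r) /\
      forall h, H h -> exists r a, In r reps /\ A a /\ h = gmul r a.

(* M g H : H is a maximal virtually abelian subgroup containing g,
   i.e. H = M(g) (in a hyperbolic group this maximal subgroup is unique). *)
Definition is_M (g : G) (H : G -> Prop) : Prop :=
  virtually_abelian H /\ H g /\
  forall K, virtually_abelian K -> subset H K -> subset K H.

Definition cyc_times (g : G) (F : G -> Prop) : G -> Prop :=
  fun h => exists (k : Z) (f : G), F f /\ h = gmul (zpow g k) f.

Definition M_is_direct (g : G) (F : G -> Prop) : Prop :=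
  (forall f, F f -> gmul g f = gmul f g) /\
  (forall (k : Z), F (zpow g k) -> zpow g k = gone) /\
  is_M g (cyc_times g F).

Definition same_set (H K : G -> Prop) : Prop := forall x, H x <-> K x.

Definition torsion_saturated : Prop :=
  (forall F1 F2 (alpha : G -> G),
     finite_subgroup F1 -> finite_subgroup F2 ->
     (forall x, F1 x -> F2 (alpha x)) ->
     (forall x y, F1 x -> F1 y -> alpha (gmul x y) = gmul (alpha x) (alpha y)) ->
     (forall x y, F1 x -> F1 y -> alpha x = alpha y -> x = y) ->
     (forall z, F2 z -> exists x, F1 x /\ alpha x = z) ->
     exists g : G, forall x, F1 x -> gmul (gmul g x) (ginv g) = alpha x)
  /\
  (forall F, finite_subgroup F ->
     exists gs : nat -> G,
       (forall n, infinite_order (gs n)) /\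
       (forall n, M_is_direct (gs n) F) /\
       (forall n m, n <> m -> ~ same_set (cyc_times (gs n) F) (cyc_times (gs m) F))).

Definition letter (S : list G) (x : G) : Prop := In x S \/ exists s, In s S /\ x = ginv s.

Definition eval_word (w : list G) : G := fold_right gmul gone w.

Definition represents (S : list G) (x : G) (n : nat) : Prop :=
  exists w : list G, length w = n /\ Forall (letter S) w /\ eval_word w = x.

Definition wdist (S : list G) (x y : G) (n : nat) : Prop :=
  represents S (gmul (ginv x) y) n /\
  forall m, represents S (gmul (ginv x) y) m -> (n <= m)%nat.

Definition generates (S : list G) : Prop := forall x : G, exists n, represents S x n.

(* Gromov hyperbolicity (four-point condition, multiplied by 2 to stay in Z):
   (x|y)_w >= min((x|z)_w, (y|z)_w) - delta for all x y z w. *)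
Definition hyperbolic : Prop :=
  exists (S : list G) (delta : nat), generates S /\
    forall (x y z w : G) (dwx dwy dwz dxy dxz dyz : nat),
      wdist S w x dwx -> wdist S w y dwy -> wdist S w z dwz ->
      wdist S x y dxy -> wdist S x z dxz -> wdist S y z dyz ->
      (Z.of_nat dwx + Z.of_nat dwy - Z.of_nat dxy >=
       Z.min (Z.of_nat dwx + Z.of_nat dwz - Z.of_nat dxz)
             (Z.of_nat dwy + Z.of_nat dwz - Z.of_nat dyz) - 2 * Z.of_nat delta)%Z.

End GroupNotions.

Arguments torsion_saturated : clear implicits.
Arguments hyperbolic : clear implicits.

Definition embeds (G H : Grp) : Prop :=
  exists phi : G -> H, (forall x y : G, phi (gmul x y) = gmul (phi x) (phi y)) /\
    (forall x y : G, phi x = phi y -> x = y).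

(* Main.v *)
(** Up to conjugacy, every finite subgroup of a hyperbolic group lies in a fixed
    ball (quasi-centres), and this ball may be taken as generating set S.  Add to G
    two stable letters for every isomorphism between finite subgroups contained in
    S.  The Cayley graph of the resulting multiple HNN extension H is a tree of
    copies of that of G, glued along sets of diameter at most 1.  So four points
    either are separated two by two by such a set, or project to four points of a
    single copy of G, whence the four-point condition.  Finite subgroups of H fix a
    vertex of the tree, i.e. are conjugate into G and then into S, and the stable
    letters realise all isomorphisms between them.  If t and u are the two letters of the
    identity of F, then u^n t u^-n has elementary closure <u^n t u^-n> x F, because
    the centraliser of every power of t is <t> x F. *)
From Stdlib Require Import ZArith List Lia FinFun Classical ClassicalEpsilon.
From Stdlib Require Import FunctionalExtensionality PropExtensionality ProofIrrelevance.
From Corelib Require Import ssreflect.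
Require Import Defs.
Import ListNotations.

(** No tree is constructed either. An element of H is a reduced word; its number of syllables
    measures how far it moves the base vertex, and its first syllable tells in which direction. All
    geometric arguments reduce to comparing the directions in which the inverse of a left factor and
    a right factor leave. Questions about exponents, which directions do not settle, are answered by
    the homomorphism to Z that counts stable letters with sign. *)

Arguments car g : simpl never.
Arguments gmul {g} x y : simpl never.
Arguments ginv {g} x : simpl never.
Arguments gone {g} : simpl never.

Declare Scope grp_scope.
Delimit Scope grp_scope with grp.
Bind Scope grp_scope with car.
Infix "*" := gmul : grp_scope.
Notation "x ^-1" := (ginv x) (at level 3, left associativity, format "x ^-1") : grp_scope.
Notation "1" := gone : grp_scope.
Open Scope grp_scope.

(** * Elementary group identities *)

Section GroupLaws.
Context {G : Grp}.
Implicit Types x y z : G.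

Lemma mulVK x y : x^-1 * (x * y) = y.
Proof. by rewrite gmulA gmulV gmul1. Qed.

Lemma mulgV x : x * x^-1 = 1.
Proof.
  rewrite -[x * x^-1](mulVK (x^-1)) [x^-1 * (x * x^-1)]gmulA gmulV gmul1; exact: gmulV.
Qed.

Lemma mulg1 x : x * 1 = x.
Proof. by rewrite -(gmulV _ x) gmulA mulgV gmul1. Qed.

Lemma mulKV x y : x * (x^-1 * y) = y.
Proof. by rewrite gmulA mulgV gmul1. Qed.

Lemma mulgI x y z : x * y = x * z -> y = z.
Proof. by move=> e; rewrite -(mulVK x y) e mulVK. Qed.

Lemma invg_unique x y : x * y = 1 -> y = x^-1.
Proof. by move=> e; apply: (mulgI x); rewrite e mulgV. Qed.

Lemma invgK x : (x^-1)^-1 = x.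
Proof. by symmetry; apply: invg_unique; apply: gmulV. Qed.

Lemma invg1 : (1 : G)^-1 = 1.
Proof. by symmetry; apply: invg_unique; apply: gmul1. Qed.

Lemma mulgA' x y z : x * y * z = x * (y * z).
Proof. by rewrite gmulA. Qed.

Lemma invMg x y : (x * y)^-1 = y^-1 * x^-1.
Proof. by symmetry; apply: invg_unique; rewrite mulgA' mulKV mulgV. Qed.

Lemma mulIg x y z : y * x = z * x -> y = z.
Proof.
  by move=> e; rewrite -(mulg1 y) -(mulgV x) gmulA e mulgA' mulgV mulg1.
Qed.

End GroupLaws.

Definition grpE G := (@mulgA' G, @gmul1 G, @mulg1 G, @gmulV G, @mulgV G,
  @mulVK G, @mulKV G, @invMg G, @invgK G, @invg1 G).

(** * Word length and the symmetric form of the four-point condition *)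

Section WordLength.
Context {G : Grp} (S : list G).
Implicit Types x y z : G.

Lemma letter_inv x : letter G S x -> letter G S x^-1.
Proof.
  move=> [h|[s [h ->]]]; [right; by exists x | left; by rewrite invgK].
Qed.

Lemma eval_word_app (v w : list G) :
  eval_word G (v ++ w) = eval_word G v * eval_word G w.
Proof. by elim: v => [|a v IH] /=; rewrite ?gmul1 // IH gmulA. Qed.

Lemma represents1 : represents G S 1 0.
Proof. by exists []. Qed.

Lemma represents_letter x : letter G S x -> represents G S x 1.
Proof. by move=> h; exists [x]; rewrite /= mulg1; auto. Qed.

Lemma represents_mul x y m n :
  represents G S x m -> represents G S y n -> represents G S (x * y) (m + n).
Proof.
  move=> [v [<- [hv <-]]] [w [<- [hw <-]]]; exists (v ++ w).
  rewrite length_app eval_word_app; split=> //; split=> //.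
  by apply/Forall_app.
Qed.

Lemma represents_inv x n : represents G S x n -> represents G S x^-1 n.
Proof.
  move=> [w [<- [hw <-]]]; elim: hw => {w} [|a w ha _ IH] /=.
    by rewrite invg1; apply: represents1.
  rewrite invMg -Nat.add_1_r; apply: represents_mul => //.
  by apply/represents_letter/letter_inv.
Qed.

Lemma represents_split x m n : represents G S x (m + n) ->
  exists y z, x = y * z /\ represents G S y m /\ represents G S z n.
Proof.
  move=> [w [hl [hw <-]]].
  exists (eval_word G (firstn m w)), (eval_word G (skipn m w)).
  rewrite -eval_word_app firstn_skipn; split=> //.
  move: hw; rewrite -{1}(firstn_skipn m w) => /Forall_app [h1 h2].
  split; [exists (firstn m w) | exists (skipn m w)]; split=> //.
    by rewrite firstn_length_le //; lia.
  by rewrite length_skipn; lia.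
Qed.

Definition wlen x : nat := epsilon (inhabits O)
  (fun n => represents G S x n /\ forall m, represents G S x m -> (n <= m)%nat).

Lemma least_nat (Q : nat -> Prop) : (exists n, Q n) ->
  exists n, Q n /\ forall m, Q m -> (n <= m)%nat.
Proof.
  move=> [n hn]; apply: NNPP => no.
  have: forall k m, (m <= k)%nat -> ~ Q m; last by move/(_ n n (le_n _)).
  elim=> [|k IH] m hm hQ; apply: no; exists m; split=> // p hp.
    lia.
  by case: (Nat.le_gt_cases m p) => // h; case: (IH p) => //; lia.
Qed.

Hypothesis gen : generates G S.

Lemma wlen_spec x : represents G S x (wlen x) /\
  forall m, represents G S x m -> (wlen x <= m)%nat.
Proof. exact: (epsilon_spec (inhabits O) _ (least_nat _ (gen x))). Qed.

Lemma wlen_rep x : represents G S x (wlen x).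
Proof. by case: (wlen_spec x). Qed.

Lemma wlen_le x n : represents G S x n -> (wlen x <= n)%nat.
Proof. by case: (wlen_spec x) => _; apply. Qed.

Lemma wlen1 : wlen 1 = 0%nat.
Proof. by have := wlen_le _ _ represents1; lia. Qed.

Lemma wlen_letter x : letter G S x -> (wlen x <= 1)%nat.
Proof. by move=> /represents_letter /wlen_le. Qed.

Lemma wlen_mul x y : (wlen (x * y) <= wlen x + wlen y)%nat.
Proof. apply: wlen_le; apply: represents_mul; exact: wlen_rep. Qed.

Lemma wlen_inv x : wlen x^-1 = wlen x.
Proof.
  have h y : (wlen y^-1 <= wlen y)%nat by apply/wlen_le/represents_inv/wlen_rep.
  by have := h x; have := h x^-1; rewrite invgK; lia.
Qed.

Lemma wlen_split x m n : wlen x = (m + n)%nat ->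
  exists y z, x = y * z /\ wlen y = m /\ wlen z = n.
Proof.
  move=> e; have := wlen_rep x; rewrite e => /represents_split.
  move=> [y [z [ex [/wlen_le hy /wlen_le hz]]]]; exists y, z; split=> //.
  by have := wlen_mul y z; rewrite -ex; lia.
Qed.

Definition wd x y := wlen (x^-1 * y).

Lemma wdE x y n : wdist G S x y n <-> n = wd x y.
Proof.
  rewrite /wdist /wd; have [h1 h2] := wlen_spec (x^-1 * y); split.
    by move=> [h3 h4]; apply: Nat.le_antisymm; auto.
  by move=> ->.
Qed.

Lemma wd_sym x y : wd x y = wd y x.
Proof. by rewrite /wd -(wlen_inv (x^-1 * y)) !grpE. Qed.

Lemma wd_triangle z x y : (wd x y <= wd x z + wd z y)%nat.
Proof.
  by have := wlen_mul (x^-1 * z) (z^-1 * y); rewrite !grpE.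
Qed.

Lemma wdL z x y : wd (z * x) (z * y) = wd x y.
Proof. by rewrite /wd !grpE. Qed.

Lemma wdxx x : wd x x = 0%nat.
Proof. by rewrite /wd gmulV wlen1. Qed.

Definition four_point (delta : nat) : Prop := forall x y z w : G,
  (wd x y + wd z w <= Nat.max (wd x z + wd y w) (wd x w + wd y z) + 2 * delta)%nat.

End WordLength.

(** Subtracting the three distances to [w] turns the inequality between Gromov products into a
    comparison of the three sums of opposite distances. *)
Lemma hyperbolicP G : hyperbolic G <->
  exists (S : list G) delta, generates G S /\ four_point S delta.
Proof.
  split=> -[S [delta [gen h]]]; exists S, delta; split=> //.
    move=> x y z w.
    have := h x y z w _ _ _ _ _ _ (proj2 (wdE S gen _ _ _) eq_refl)
      (proj2 (wdE S gen _ _ _) eq_refl) (proj2 (wdE S gen _ _ _) eq_refl)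
      (proj2 (wdE S gen _ _ _) eq_refl) (proj2 (wdE S gen _ _ _) eq_refl)
      (proj2 (wdE S gen _ _ _) eq_refl).
    by rewrite !(wd_sym S gen w); lia.
  move=> x y z w ? ? ? ? ? ?; rewrite !wdE // => -> -> -> -> -> ->.
  by have := h x y z w; rewrite !(wd_sym S gen w); lia.
Qed.

(** * Powers, virtually abelian subgroups and conjugation *)

Section Powers.
Context {G : Grp}.
Implicit Types x y z : G.

Definition comm x y : Prop := x * y = y * x.

Lemma comm_sym x y : comm x y -> comm y x.
Proof. by move=> h; symmetry. Qed.

Lemma commM x y z : comm x y -> comm x z -> comm x (y * z).
Proof. by rewrite /comm => h1 h2; rewrite gmulA h1 mulgA' h2 gmulA. Qed.

Lemma commV x y : comm x y -> comm x y^-1.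
Proof.
  rewrite /comm => h; apply: (mulgI y); apply: (mulIg y).
  by rewrite !grpE h.
Qed.

Lemma comm1 x : comm x 1.
Proof. by rewrite /comm mulg1 gmul1. Qed.

Lemma comm_gpow x y n : comm x y -> comm x (gpow G y n).
Proof. by move=> h; elim: n => [|n IH] /=; [apply: comm1 | apply: commM]. Qed.

Lemma comm_zpow x y k : comm x y -> comm x (zpow G y k).
Proof.
  move=> h; rewrite /zpow; case: (Z.leb _ _); first exact: comm_gpow.
  exact/commV/comm_gpow.
Qed.

Lemma gpow_add x m n : gpow G x (m + n) = gpow G x m * gpow G x n.
Proof. by elim: m => [|m IH] /=; rewrite ?gmul1 // IH gmulA. Qed.

Lemma gpow_mul x m n : gpow G x (m * n) = gpow G (gpow G x m) n.
Proof.
  elim: n => [|n IH] /=; first by rewrite Nat.mul_0_r.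
  by rewrite Nat.mul_succ_r Nat.add_comm gpow_add IH.
Qed.

Lemma gpow1 n : gpow G 1 n = 1.
Proof. by elim: n => [//|n IH] /=; rewrite IH gmul1. Qed.

Lemma gpow_commM x y n : comm x y -> gpow G (x * y) n = gpow G x n * gpow G y n.
Proof.
  move=> h; elim: n => [|n IH] /=; first by rewrite gmul1.
  have e := comm_gpow y x n (comm_sym _ _ h); rewrite /comm in e.
  by rewrite IH !mulgA' -(mulgA' (gpow G x n) y) -e !mulgA'.
Qed.

Lemma gpow_conj c x n : gpow G (c * x * c^-1) n = c * gpow G x n * c^-1.
Proof.
  elim: n => [|n IH] /=; first by rewrite mulg1 mulgV.
  by rewrite IH !grpE.
Qed.

Lemma gpowV x n : gpow G x^-1 n = (gpow G x n)^-1.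
Proof.
  apply: invg_unique; rewrite -gpow_commM ?mulgV ?gpow1 //.
  by rewrite /comm mulgV gmulV.
Qed.

Lemma zpow_sub x m n :
  zpow G x (Z.of_nat m - Z.of_nat n) = gpow G x m * (gpow G x n)^-1.
Proof.
  rewrite /zpow; case: (Z.leb_spec 0 (Z.of_nat m - Z.of_nat n)) => h.
    have {2}-> : m = (Z.to_nat (Z.of_nat m - Z.of_nat n) + n)%nat by lia.
    by rewrite gpow_add mulgA' mulgV mulg1.
  have {2}-> : n = (Z.to_nat (- (Z.of_nat m - Z.of_nat n)) + m)%nat by lia.
  by rewrite gpow_add invMg mulKV.
Qed.

Lemma zpow_nat x n : zpow G x (Z.of_nat n) = gpow G x n.
Proof.
  by rewrite -(Z.sub_0_r (Z.of_nat n)) (zpow_sub x n 0) /= invg1 mulg1.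
Qed.

Lemma zpow_add x k l : zpow G x (k + l) = zpow G x k * zpow G x l.
Proof.
  have H (i : Z) : exists m n, i = (Z.of_nat m - Z.of_nat n)%Z.
    by exists (Z.to_nat i), (Z.to_nat (- i)); lia.
  have [a [b ->]] := H k; have [c [d ->]] := H l.
  have -> : (Z.of_nat a - Z.of_nat b + (Z.of_nat c - Z.of_nat d) =
    Z.of_nat (a + c) - Z.of_nat (d + b))%Z by lia.
  rewrite !zpow_sub !gpow_add invMg !mulgA'; congr (_ * _).
  have cxx : comm x x by [].
  have h := commV _ _ (comm_gpow _ _ b (comm_sym _ _ (comm_gpow x x c cxx))).
  by rewrite gmulA h mulgA'.
Qed.

Lemma zpow1 x : zpow G x 1 = x.
Proof. by rewrite (zpow_nat x 1) /= mulg1. Qed.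

Lemma zpowV x k : zpow G x (- k) = (zpow G x k)^-1.
Proof. by apply: invg_unique; rewrite -zpow_add Z.add_opp_diag_r. Qed.

Lemma zpow_conj c x k : zpow G (c * x * c^-1) k = c * zpow G x k * c^-1.
Proof.
  by rewrite /zpow; case: (Z.leb _ _); rewrite gpow_conj // !invMg invgK mulgA'.
Qed.

Lemma finite_subset (A : G -> Prop) (l : list G) :
  (forall x, A x -> In x l) -> finite_set G A.
Proof.
  elim: l A => [|a l IH] A hA; first by exists [] => x; split=> // /hA.
  have [|l' hl'] := IH (fun x => A x /\ x <> a).
    by move=> x [/hA [<-|//] h]; case: h.
  case: (classic (A a)) => ha; [exists (a :: l') | exists l'] => x.
    rewrite /= -hl'; split=> [hx|[<- //|[]//]].
    by case: (classic (x = a)) => [->|]; [left | right].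
  by rewrite -hl'; split=> [hx|[]//]; split=> // ex; apply: ha; rewrite -ex.
Qed.

Lemma pigeonhole (f : nat -> G) (l : list G) : (forall n, In (f n) l) ->
  exists i j, (i < j)%nat /\ f i = f j.
Proof.
  move=> hf; apply: NNPP => no.
  have inj : Injective f.
    move=> i j e; case: (Nat.lt_trichotomy i j) => [h|[//|h]].
      by case: no; exists i, j.
    by case: no; exists j, i.
  have nd := Injective_map_NoDup inj (seq_NoDup (Datatypes.S (length l)) 0).
  have sub : incl (map f (seq 0 (Datatypes.S (length l)))) l.
    by move=> _ /in_map_iff [n [<- _]].
  by have := NoDup_incl_length nd sub; rewrite length_map length_seq; lia.
Qed.

Lemma finite_subgroup_torsion (F : G -> Prop) x : finite_subgroup G F -> F x ->
  exists n, n <> O /\ gpow G x n = 1.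
Proof.
  move=> [[F1 [FM FV]] [l hl]] Fx.
  have [|i [j [lt e]]] := pigeonhole (gpow G x) l.
    by elim=> [|n /hl IH]; apply/hl => //=; apply: FM.
  exists (j - i)%nat; split; first lia.
  apply: (mulgI (gpow G x i)); rewrite mulg1 -gpow_add e; congr gpow; lia.
Qed.

(** By pigeonhole on coset representatives, each element of [K] has a nontrivial exponent bringing
    it into the abelian subgroup of finite index; the product of the exponents for [x] and for its
    conjugate serves both. *)
Lemma virtually_abelian_power_comm (K : G -> Prop) x k :
  virtually_abelian G K -> K x -> K k ->
  exists n, n <> O /\ comm (gpow G x n) (k * gpow G x n * k^-1).
Proof.
  move=> [[K1 [KM KV]] [A [[A1 [AM AV]] [AK [Aab [reps [hr hreps]]]]]]] Kx Kk.
  have powA y : K y -> exists n, n <> O /\ A (gpow G y n).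
    move=> Ky; have Kyn n : K (gpow G y n) by elim: n => [//|n IH] /=; apply: KM.
    pose Q n r := In r reps /\ exists a, A a /\ gpow G y n = r * a.
    pose f n := epsilon (inhabits 1) (Q n).
    have hf n : Q n (f n).
      apply: epsilon_spec; have [r [a [h1 [h2 h3]]]] := hreps _ (Kyn n).
      by exists r; split=> //; exists a.
    have [|i [j [lt e]]] := pigeonhole f reps; first by move=> n; case: (hf n).
    have [_ [a [Aa ea]]] := hf i; have [_ [b [Ab eb]]] := hf j.
    exists (j - i)%nat; split; first lia.
    have -> : gpow G y (j - i) = a^-1 * b; last by apply: AM => //; apply: AV.
    apply: (mulgI (gpow G y i)); rewrite -gpow_add.
    have -> : (i + (j - i) = j)%nat by lia.
    by rewrite eb ea -e !grpE.
  have Apow a n : A a -> A (gpow G a n) by move=> Aa; elim: n => [//|n IH]; apply: AM.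
  have [p [p0 Ap]] := powA x Kx.
  have [|q [q0 Aq]] := powA (k * x * k^-1); first exact: (KM _ _ (KM _ _ Kk Kx) (KV _ Kk)).
  exists (p * q)%nat; split; first lia.
  apply: Aab; first by rewrite gpow_mul; apply: Apow.
  by rewrite -gpow_conj Nat.mul_comm gpow_mul; apply: Apow.
Qed.

(** This is c K c^-1, written as a preimage so that membership unfolds without an existential. *)
Definition conj_set (c : G) (K : G -> Prop) : G -> Prop := fun x => K (c^-1 * x * c).

Lemma conj_set_subgroup c K : subgroup G K -> subgroup G (conj_set c K).
Proof.
  rewrite /conj_set => -[K1 [KM KV]]; split; [|split] => [|x y hx hy|x hx].
  - by rewrite mulg1 gmulV.
  - by have := KM _ _ hx hy; rewrite !grpE.
  - by have := KV _ hx; rewrite !grpE.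
Qed.

Lemma conj_set_virtually_abelian c K :
  virtually_abelian G K -> virtually_abelian G (conj_set c K).
Proof.
  move=> [sK [A [sA [AK [Aab [reps [hr hreps]]]]]]]; split; first exact: conj_set_subgroup.
  exists (conj_set c A); split; first exact: conj_set_subgroup.
  split; first by move=> x; apply: AK.
  split=> [x y hx hy|].
    apply: (mulgI c^-1); apply: (mulIg c).
    by have := Aab _ _ hx hy; rewrite !grpE.
  exists (map (fun r => c * r * c^-1) reps); split=> [_ /in_map_iff [r [<- /hr h]]|x hx].
    by rewrite /conj_set !grpE.
  have [r [a [h1 [h2 h3]]]] := hreps _ hx.
  exists (c * r * c^-1), (c * a * c^-1); rewrite /conj_set !grpE.
  split; first by apply/in_map_iff; exists r; rewrite !grpE.
  split=> //; apply: (mulgI c^-1); apply: (mulIg c); move: h3; rewrite !grpE.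
  by [].
Qed.

Lemma cyc_times_conj c g K x : cyc_times G (c * g * c^-1) (conj_set c K) x <->
  conj_set c (cyc_times G g K) x.
Proof.
  rewrite /conj_set; split=> -[k [f [hf e]]].
    exists k, (c^-1 * f * c); split=> //; rewrite e zpow_conj !grpE.
    by [].
  exists k, (c * f * c^-1); rewrite zpow_conj !grpE; split=> //.
  by apply: (mulgI c^-1); apply: (mulIg c); move: e; rewrite !grpE.
Qed.

(** Finite subgroups of the extension are only conjugate to edge groups, so the closures computed
    for edge groups must be carried along a conjugation. *)
Lemma M_is_direct_conj c g K :
  M_is_direct G g K -> M_is_direct G (c * g * c^-1) (conj_set c K).
Proof.
  move=> [hc [hk [vM [gM maxM]]]]; have sets x := cyc_times_conj c g K x.
  have ext : cyc_times G (c * g * c^-1) (conj_set c K) = conj_set c (cyc_times G g K).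
    apply: functional_extensionality => x; apply: propositional_extensionality.
    exact: sets.
  split=> [f /hc e|].
    by apply: (mulgI c^-1); apply: (mulIg c); move: e; rewrite !grpE.
  split=> [k|].
    by rewrite zpow_conj /conj_set !grpE => /hk ->; rewrite gmul1 mulgV.
  rewrite ext; split; first exact: conj_set_virtually_abelian.
  split; first by rewrite /conj_set !grpE; move: gM; rewrite ?mulg1.
  move=> L vL sub x Lx.
  apply: (maxM (conj_set c^-1 L)); first exact: conj_set_virtually_abelian.
    by move=> y hy; apply: sub; rewrite /conj_set !grpE.
  by rewrite /conj_set !grpE.
Qed.

End Powers.
Lemma argmin {T : Type} (f : T -> nat) (c0 : T) : exists c, forall c', (f c <= f c')%nat.
Proof.
  have [n [[c <-] h]] : exists n, (exists c, f c = n) /\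
    forall m, (exists c, f c = m) -> (n <= m)%nat by apply: least_nat; exists (f c0), c0.
  by exists c => c'; apply: h; exists c'.
Qed.

(** * Quasi-centres and rescaled generating sets *)

Section QuasiCentre.
Context {G : Grp} (S : list G) (delta : nat).
Hypotheses (gen : generates G S) (hyp : four_point S delta).

Definition eccentricity (l : list G) (c : G) : nat := list_max (map (wd S c) l).

Lemma eccentricity_le l c n :
  (eccentricity l c <= n)%nat <-> forall f, In f l -> (wd S c f <= n)%nat.
Proof.
  rewrite list_max_le Forall_map Forall_forall; by [].
Qed.

(* A centre c of the orbit F is moved only slightly by h in F, since c and h c
   are both centres and by hyperbolicity their midpoint would otherwise do better. *)
Lemma finite_subgroup_quasi_centre (F : G -> Prop) : finite_subgroup G F ->
  exists c, forall h, F h -> (wlen S (c^-1 * h * c) <= 4 * delta + 1)%nat.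
Proof.
  move=> [[F1 [FM FV]] [l hl]].
  have [c hc] := argmin (eccentricity l) 1; exists c => h Fh.
  set r := eccentricity l c in hc.
  have bound_c f : F f -> (wd S c f <= r)%nat.
    by move=> /hl; move: f; apply/eccentricity_le.
  have bound_hc f : F f -> (wd S (h * c) f <= r)%nat.
    move=> Ff; rewrite -(wdL S h^-1) mulVK; apply: bound_c; auto.
  set D := wlen S (c^-1 * h * c).
  (* A geodesic from [c] to [h * c] is cut in its middle; [c * y] is the midpoint. *)
  have eD : wlen S (c^-1 * h * c) = (D / 2 + (D - D / 2))%nat.
    by rewrite -/D; have := Nat.Div0.div_le_upper_bound D 2 D; lia.
  have [y [z [ex [hy hz]]]] := wlen_split S gen _ _ _ eD.
  have em1 : wd S c (c * y) = (D / 2)%nat by rewrite /wd mulVK.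
  have em2 : wd S (h * c) (c * y) = (D - D / 2)%nat.
    rewrite wd_sym // /wd -hz; congr wlen.
    by rewrite !grpE -(mulgA' c^-1) ex !grpE.
  have ecc : wd S c (h * c) = D by rewrite /wd gmulA.
  (* For the midpoint m, the four-point condition bounds D + d(m, f) by r + (D - D / 2) + 2
     delta. *)
  have : (eccentricity l (c * y) <= r - D / 2 + 2 * delta)%nat.
    apply/eccentricity_le => f /hl Ff.
    have := hyp c (h * c) (c * y) f.
    rewrite em1 em2 ecc; have := bound_c f Ff; have := bound_hc f Ff.
    by have := Nat.div_mod_eq D 2; have := Nat.mod_upper_bound D 2; lia.
  have := hc (c * y); have := Nat.div_mod_eq D 2; have := Nat.mod_upper_bound D 2.
  (* As [1] lies in the orbit, D is at most 2 r, so the truncated subtraction above is exact;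
     minimality of r then bounds D / 2 by 2 delta. *)
  have := wd_triangle S gen 1 c (h * c).
  by have := bound_c _ F1; have := bound_hc _ F1; rewrite ecc (wd_sym S gen 1 (h * c)); lia.
Qed.

Lemma wlen0 x : wlen S x = 0%nat -> x = 1.
Proof. by have := wlen_rep S gen x => /[swap] -> -[[|a w] [// _ [_ <-]]]. Qed.

Lemma wlen1_letter x : wlen S x = 1%nat -> letter G S x.
Proof.
  have := wlen_rep S gen x => /[swap] -> -[[|a [|b w]] [//= _ [hw <-]]].
  by rewrite mulg1; inversion hw.
Qed.

Lemma ball_finite n : exists l : list G, forall x, In x l <-> (wlen S x <= n)%nat.
Proof.
  have [l hl] : exists l : list G, forall x, (wlen S x <= n)%nat -> In x l.
    elim: n => [|n [l hl]].
      by exists [1] => x h; left; symmetry; apply: wlen0; lia.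
    exists (l ++ flat_map (fun s => map (gmul s) l) (S ++ map ginv S)) => x h.
    apply/in_app_iff; case: (Nat.eq_dec (wlen S x) (1 + n)) => e; last first.
      by left; apply: hl; lia.
    right; have [y [z [-> [hy hz]]]] := wlen_split S gen _ _ _ e.
    apply/in_flat_map; exists y; split; last by apply: in_map; apply: hl; lia.
    apply/in_app_iff; case: (wlen1_letter y hy) => [|[s [hs ->]]]; first by left.
    by right; apply: in_map.
  exists (filter (fun x => Nat.leb (wlen S x) n) l) => x.
  rewrite filter_In Nat.leb_le; split; [by case | by auto].
Qed.

Section Rescale.
Context (r : nat) (ball : list G).
Hypotheses (r_gt0 : (0 < r)%nat)
  (ballP : forall x, In x ball <-> (wlen S x <= r)%nat).

Lemma letter_ball x : letter G ball x <-> (wlen S x <= r)%nat.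
Proof.
  split; last by left; apply/ballP.
  by move=> [/ballP //|[s [/ballP h ->]]]; rewrite wlen_inv.
Qed.

Lemma ball_represents n x : (wlen S x <= r * n)%nat -> represents G ball x n.
Proof.
  elim: n x => [|n IH] x h.
    have -> : x = 1 by apply: wlen0; lia.
    exact: represents1.
  case: (Nat.le_gt_cases (wlen S x) r) => hr.
    rewrite -(gmul1 _ x) -Nat.add_1_r; apply: represents_mul.
      by apply: IH; rewrite wlen1 //; lia.
    by apply/represents_letter/letter_ball.
  have e : wlen S x = (r + (wlen S x - r))%nat by lia.
  have [y [z [ex [hy hz]]]] := wlen_split S gen _ _ _ e.
  rewrite ex -Nat.add_1_l; apply: represents_mul; last by apply: IH; lia.
  by apply/represents_letter/letter_ball; lia.
Qed.

Lemma represents_ball n x : represents G ball x n -> (wlen S x <= r * n)%nat.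
Proof.
  move=> [w [<- [hw <-]]]; elim: hw => {w} [|a w /letter_ball ha _ IH] /=.
    by rewrite wlen1 //; lia.
  by have := wlen_mul S gen a (eval_word G w); lia.
Qed.

Lemma ball_generates : generates G ball.
Proof. move=> x; exists (wlen S x); apply: ball_represents.
  by have := Nat.mul_le_mono_r 1 r (wlen S x); lia. Qed.

(** The new length is the old one divided by [r] and rounded up: a geodesic is cut into pieces of
    length [r] and one remainder. *)
Lemma ball_wlen x :
  (wlen S x <= r * wlen ball x)%nat /\ (r * wlen ball x < wlen S x + r)%nat.
Proof.
  split; first by apply/represents_ball/wlen_rep/ball_generates.
  set q := (wlen S x / r)%nat.
  have eq := Nat.div_mod_eq (wlen S x) r; have lt := Nat.mod_upper_bound (wlen S x) r.
  case: (Nat.eq_dec (wlen S x mod r) 0) => h0.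
    have : (wlen ball x <= q)%nat.
      by apply/wlen_le; [exact: ball_generates | apply: ball_represents; rewrite /q; lia].
    by rewrite /q; nia.
  have : (wlen ball x <= q + 1)%nat.
    by apply/wlen_le; [exact: ball_generates | apply: ball_represents; rewrite /q; nia].
  by rewrite /q; nia.
Qed.

(** Dividing by [r] does not increase delta. Rounding up adds less than 1 to each length, hence less
    than 2 to a sum of two, which the extra 1 absorbs. *)
Lemma ball_four_point : four_point ball (delta + 1).
Proof.
  move=> x y z w; have := hyp x y z w; rewrite /wd.
  have := ball_wlen (x^-1 * y); have := ball_wlen (z^-1 * w).
  have := ball_wlen (x^-1 * z); have := ball_wlen (y^-1 * w).
  have := ball_wlen (x^-1 * w); have := ball_wlen (y^-1 * z).
  move: (wlen ball _) => a1; move: (wlen ball _) => a2; move: (wlen ball _) => a3.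
  move: (wlen ball _) => a4; move: (wlen ball _) => a5; move: (wlen ball _) => a6.
  move: (wlen S _) => b1; move: (wlen S _) => b2; move: (wlen S _) => b3.
  move: (wlen S _) => b4; move: (wlen S _) => b5; move: (wlen S _) => b6.
  move=> h1 h2 h3 h4 h5 h6 h; apply/Nat.nlt_ge => lt.
  have m1 : (a4 + a3 + 2 * delta + 3 <= a6 + a5)%nat by lia.
  have m2 : (a2 + a1 + 2 * delta + 3 <= a6 + a5)%nat by lia.
  have := Nat.mul_le_mono_l _ _ r m1; have := Nat.mul_le_mono_l _ _ r m2.
  have := Nat.mul_le_mono_r 1 r delta.
  by lia.
Qed.

End Rescale.
End QuasiCentre.

Lemma hyperbolic_saturating_generators G : hyperbolic G ->
  exists (S : list G) delta, generates G S /\ four_point S delta /\ In 1 S /\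
    (forall F, finite_subgroup G F -> exists c, forall h, F h -> In (c^-1 * h * c) S).
Proof.
  move=> /hyperbolicP [S [delta [gen hyp]]].
  (* The radius is the displacement bound at a quasi-centre; its summand 1 also keeps it positive
     when [delta] is 0. *)
  have [ball ballP] := ball_finite S gen (4 * delta + 1).
  have r_gt0 : (0 < 4 * delta + 1)%nat by lia.
  exists ball, (delta + 1)%nat; split; first exact: (ball_generates S gen _ _ r_gt0 ballP).
  split; first exact: (ball_four_point S delta gen hyp _ _ r_gt0 ballP).
  split; first by apply/ballP; rewrite wlen1 //; lia.
  move=> F /(finite_subgroup_quasi_centre S delta gen hyp) [c hc].
  by exists c => h /hc /ballP.
Qed.

(** * Partial isomorphisms *)

Section PartialIso.
Context {G : Grp}.

(** As a relation, an isomorphism is inverted by swapping its arguments, and between finite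
    subgroups it is a finite set of pairs. Being functional and injective is asked at 1 only;
    products and inverses give the rest. *)
Record partial_iso (P : G -> G -> Prop) : Prop := {
  partial_iso1 : P 1 1;
  partial_isoM : forall x y x' y', P x x' -> P y y' -> P (x * y) (x' * y');
  partial_isoV : forall x x', P x x' -> P x^-1 x'^-1;
  partial_iso_fun : forall y, P 1 y -> y = 1;
  partial_iso_inj : forall x, P x 1 -> x = 1
}.

End PartialIso.

(** * Multiple HNN extensions *)

Section HNN.
Context {G : Grp} {I : Type} (P : I -> G -> G -> Prop).
Hypothesis isoP : forall i, partial_iso (P i).
Implicit Types (x y g : G).

(* An oriented edge e = (i, b) carries the stable letter t_i (b = true) or its
   inverse; the relation is a * t_e = t_e * a' whenever [rel e a a']. *)
Definition edge : Type := I * bool.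
Implicit Types e : edge.
Definition bar e : edge := (fst e, negb (snd e)).
Definition rel e x y : Prop := if snd e then P (fst e) x y else P (fst e) y x.
Definition dom e x : Prop := exists y, rel e x y.
(** Two choices: [phi e] is the associated isomorphism, meaningful on [dom e] only, and [rep e]
    picks a point in each left coset of [dom e], not necessarily 1 in the trivial coset. *)
Definition phi e x : G := epsilon (inhabits 1) (rel e x).
Definition rep e x : G := epsilon (inhabits 1) (fun y => dom e (x^-1 * y)).

Lemma barK e : bar (bar e) = e.
Proof. by case: e => i []. Qed.

Lemma bar_neq e : bar e <> e.
Proof. by case: e => i []. Qed.

Lemma rel_bar e x y : rel (bar e) x y <-> rel e y x.
Proof. by case: e => i []. Qed.

Lemma rel1 e : rel e 1 1.
Proof. by case: e => i [] /=; exact: (partial_iso1 _ (isoP i)). Qed.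

Lemma relM e x y x' y' : rel e x x' -> rel e y y' -> rel e (x * y) (x' * y').
Proof. by case: e => i [] /=; apply: (partial_isoM _ (isoP i)). Qed.

Lemma relV e x x' : rel e x x' -> rel e x^-1 x'^-1.
Proof. by case: e => i [] /=; apply: (partial_isoV _ (isoP i)). Qed.

Lemma rel1_eq e x : rel e 1 x -> x = 1.
Proof.
  case: e => i [] /=; first exact: (partial_iso_fun _ (isoP i)).
  exact: (partial_iso_inj _ (isoP i)).
Qed.

Lemma rel_fun e x y z : rel e x y -> rel e x z -> z = y.
Proof.
  move=> /relV h1 h2; apply: (mulgI y^-1); rewrite gmulV.
  by apply: (rel1_eq e); rewrite -(gmulV _ x); apply: relM.
Qed.

Lemma dom1 e : dom e 1.
Proof. by exists 1; apply: rel1. Qed.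

Lemma domM e x y : dom e x -> dom e y -> dom e (x * y).
Proof. by move=> [x' hx] [y' hy]; exists (x' * y'); apply: relM. Qed.

Lemma domV e x : dom e x -> dom e x^-1.
Proof. by move=> [x' hx]; exists x'^-1; apply: relV. Qed.

Lemma domMl e x y : dom e x -> (dom e (x * y) <-> dom e y).
Proof.
  move=> hx; split; last exact: domM.
  by rewrite -{2}(mulVK x y); apply: domM; apply: domV.
Qed.

Lemma domMr e x y : dom e y -> (dom e (x * y) <-> dom e x).
Proof.
  move=> hy; split=> [h|h]; last exact: domM.
  have -> : x = x * y * y^-1 by rewrite !grpE.
  by apply: domM => //; apply: domV.
Qed.

Lemma dom_invP e x : dom e x^-1 <-> dom e x.
Proof. by split=> /domV; rewrite ?invgK. Qed.

Lemma phi_rel e x : dom e x -> rel e x (phi e x).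
Proof. exact: epsilon_spec. Qed.

Lemma phiE e x y : rel e x y -> phi e x = y.
Proof. by move=> h; apply: (rel_fun e x) => //; apply: phi_rel; exists y. Qed.

Lemma phi_dom e x : dom e x -> dom (bar e) (phi e x).
Proof. by move=> /phi_rel h; exists x; apply/rel_bar. Qed.

Lemma phiK e x : dom e x -> phi (bar e) (phi e x) = x.
Proof. by move=> /phi_rel h; apply/phiE/rel_bar. Qed.

Lemma phi1 e : phi e 1 = 1.
Proof. exact/phiE/rel1. Qed.

Lemma phiM e x y : dom e x -> dom e y -> phi e (x * y) = phi e x * phi e y.
Proof. by move=> /phi_rel hx /phi_rel hy; apply/phiE/relM. Qed.

Lemma rep_dom e x : dom e (x^-1 * rep e x).
Proof.
  apply: (epsilon_spec (inhabits (1 : G)) (fun y => dom e (x^-1 * y))).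
  by exists x; rewrite gmulV; apply: dom1.
Qed.

Lemma rep_dom' e x : dom e ((rep e x)^-1 * x).
Proof. by have /domV := rep_dom e x; rewrite !grpE. Qed.

Lemma rep_eq e x y : dom e (x^-1 * y) -> rep e x = rep e y.
Proof.
  move=> h; rewrite /rep; congr epsilon; apply: functional_extensionality => z.
  apply: propositional_extensionality.
  have -> : x^-1 * z = (x^-1 * y) * (y^-1 * z) by rewrite !grpE.
  exact: domMl.
Qed.

Lemma rep_eqP e x y : rep e x = rep e y <-> dom e (x^-1 * y).
Proof.
  split; last exact: rep_eq.
  move=> h; have := domM _ _ _ (rep_dom e x) (rep_dom' e y).
  by rewrite h !grpE.
Qed.

Lemma rep_mulr e x a : dom e a -> rep e (x * a) = rep e x.
Proof. by move=> ha; symmetry; apply: rep_eq; rewrite mulVK. Qed.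

Lemma rep_rep e x : rep e (rep e x) = rep e x.
Proof. by symmetry; apply: rep_eq; apply: rep_dom. Qed.

Lemma rep_mull_rep e g x : rep e (g * rep e x) = rep e (g * x).
Proof. by symmetry; apply: rep_eq; rewrite !grpE; apply: rep_dom. Qed.

Lemma dom_rep e x : dom e (rep e x) <-> dom e x.
Proof.
  have {1}-> : rep e x = x * (x^-1 * rep e x) by rewrite !grpE.
  exact/domMr/rep_dom.
Qed.

(* The list [(r_n, e_n); ...; (r_1, e_1)] and the element g encode
   r_1 t_{e_1} ... r_n t_{e_n} g, so that right multiplication by a generator
   only affects the head of the list. *)
Definition syllable : Type := G * edge.
Definition nform : Type := list syllable * G.
Implicit Types (l : list syllable) (u v : nform).

(** The test is [dom e g] rather than triviality of a representative, because [dom e] itself may be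
    represented by an element other than 1. *)
Definition cancels e l g : Prop :=
  match l with [] => False | (_, e') :: _ => e' = bar e /\ dom e g end.

Fixpoint reduced l : Prop :=
  match l with
  | [] => True
  | (r, e) :: l' => rep e r = r /\ ~ cancels e l' r /\ reduced l'
  end.

(** Writing g = r a with a in [dom e], one has g t_e = r t_e a' with a' the image of a. *)
Definition push e l g : nform := ((rep e g, e) :: l, phi e ((rep e g)^-1 * g)).

Definition pop e l g : nform :=
  match l with [] => (l, g) | (r, _) :: l' => (l', r * phi e g) end.

Definition step u (a : G + edge) : nform :=
  match a with
  | inl g => (fst u, snd u * g)
  | inr e => match excluded_middle_informative (cancels e (fst u) (snd u)) with
             | left _ => pop e (fst u) (snd u)
             | right _ => push e (fst u) (snd u)
             end
  end.

Lemma step_pop e r l g : dom e g ->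
  step ((r, bar e) :: l, g) (inr e) = (l, r * phi e g).
Proof.
  by move=> h /=; case: excluded_middle_informative => // -[]; split.
Qed.

Lemma step_push e l g : ~ cancels e l g -> step (l, g) (inr e) = push e l g.
Proof. by move=> h /=; case: excluded_middle_informative. Qed.

Lemma stepP u e :
  (exists r l, u = ((r, bar e) :: l, snd u) /\ dom e (snd u) /\
     step u (inr e) = (l, r * phi e (snd u))) \/
  (~ cancels e (fst u) (snd u) /\ step u (inr e) = push e (fst u) (snd u)).
Proof.
  case: u => l g; case: (classic (cancels e l g)) => h; [left|right].
    case: l h => [//|[r e'] l] /= [-> h].
    by exists r, l; split=> //; split=> //; apply: step_pop.
  by split=> //; apply: step_push.
Qed.

Lemma step_reduced u a : reduced (fst u) -> reduced (fst (step u a)).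
Proof.
  case: a => [g //|e]; case: (stepP u e) => [[r [l [-> [h ->]]]]|[h ->]] /=.
    by tauto.
  move=> hl; rewrite rep_rep; split=> //; split=> //.
  by case: u h hl => [[|[r e'] l] g] //= h _; rewrite dom_rep.
Qed.

Definition act u (w : list (G + edge)) : nform := fold_left step w u.

Lemma act_reduced w u : reduced (fst u) -> reduced (fst (act u w)).
Proof. by elim: w u => [//|a w IH] u hu /=; apply/IH/step_reduced. Qed.

Lemma act_app u w w' : act u (w ++ w') = act (act u w) w'.
Proof. exact: fold_left_app. Qed.

Lemma step_mul u g g' : step (step u (inl g)) (inl g') = step u (inl (g * g')).
Proof. by rewrite /= gmulA. Qed.

Lemma step1 u : step u (inl 1) = u.
Proof. by case: u => l g /=; rewrite mulg1. Qed.

Lemma cancels_mulr e l g a : dom e a -> (cancels e l (g * a) <-> cancels e l g).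
Proof. by move=> ha; case: l => [//|[r e'] l] /=; rewrite (domMr e g a). Qed.

Lemma step_rel e a b u : rel e a b ->
  step (step u (inl a)) (inr e) = step (step u (inr e)) (inl b).
Proof.
  move=> hab; have ha : dom e a by exists b.
  case: u => l g; case: (classic (cancels e l g)) => h.
    case: l h => [//|[r e'] l] [-> h].
    have -> : step ((r, bar e) :: l, g) (inl a) = ((r, bar e) :: l, g * a) by [].
    rewrite (step_pop e r l g) // (step_pop e r l (g * a)); first exact: domM.
    by rewrite /= phiM // (phiE e a b) // gmulA.
  have -> : step (l, g) (inl a) = (l, g * a) by [].
  rewrite (step_push e l g) // (step_push e l (g * a)) ?cancels_mulr //.
  rewrite /push /= rep_mulr // gmulA phiM ?(phiE e a b) //.
  exact: rep_dom'.
Qed.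

(** Reducedness enters here: a popped syllable is restored only if it carried the chosen
    representative and did not itself cancel. *)
Lemma step_barK e u : reduced (fst u) -> step (step u (inr e)) (inr (bar e)) = u.
Proof.
  case: (stepP u e) => [[r [l [-> [h ->]]]]|[h ->]] /= hu.
    case: hu => hr [hc _]; move: h; case: u hc hr => _ g /= hc hr h.
    have hd := phi_dom _ _ h.
    rewrite -[match _ with left _ => _ | right _ => _ end]/(step (l, r * phi e g) (inr (bar e))).
    rewrite step_push ?cancels_mulr // /push rep_mulr // hr.
    by rewrite mulVK phiK.
  have hd := rep_dom' e (snd u).
  rewrite -[match _ with left _ => _ | right _ => _ end]/(step (push e (fst u) (snd u)) (inr (bar e))).
  rewrite /push -{2}(barK e) step_pop; first exact: phi_dom.
  by rewrite phiK // mulKV; case: u {h hu hd}.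
Qed.

Fixpoint list_word l : list (G + edge) :=
  match l with [] => [] | (r, e) :: l' => list_word l' ++ [inl r; inr e] end.

Definition word u : list (G + edge) := list_word (fst u) ++ [inl (snd u)].

Lemma act_list_word l : reduced l -> act ([], 1) (list_word l) = (l, 1).
Proof.
  elim: l => [//|[r e] l IH] /= [hr [hc hl]].
  rewrite act_app IH //; change (step (l, 1 * r) (inr e) = ((r, e) :: l, 1)).
  by rewrite gmul1 step_push // /push hr gmulV phi1.
Qed.

Lemma act_word u : reduced (fst u) -> act ([], 1) (word u) = u.
Proof. by move=> h; rewrite act_app act_list_word //= gmul1; case: u h. Qed.

(** The word of [step v a] and the word of [v] followed by [a] differ by defining relations, and
    these hold for the action by [step_rel] and [step_barK]. Associativity of the product rests on
    this. *)
Lemma act_word_step u v a : reduced (fst u) -> reduced (fst v) ->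
  act u (word (step v a)) = step (act u (word v)) a.
Proof.
  move=> hu; case: a => [g|e] hv.
    by rewrite /word !act_app; symmetry; apply: step_mul.
  have hv' : reduced (fst (act u (word v))) by apply: act_reduced.
  case: (stepP v e) hv => [[r [l [-> [h ->]]]]|[h ->]] hv.
    case: v hv h {hv'} => _ g /= [hr [hc hl]] h.
    rewrite /word /= !act_app.
    set w := act u _.
    have hw : reduced (fst w) by apply: act_reduced.
    change (step w (inl (r * phi e g)) =
      step (step (step (step w (inl r)) (inr (bar e))) (inl g)) (inr e)).
    rewrite (step_rel e g (phi e g)); first exact: phi_rel.
    rewrite -{3}(barK e) step_barK ?step_mul //; exact: step_reduced.
  rewrite /word /= !act_app; set w := act u _.
  change (step (step (step w (inl (rep e (snd v)))) (inr e))
    (inl (phi e ((rep e (snd v))^-1 * snd v))) = step (step w (inl (snd v))) (inr e)).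
  rewrite -(step_rel e ((rep e (snd v))^-1 * snd v)); first exact/phi_rel/rep_dom'.
  by rewrite step_mul mulKV.
Qed.

Lemma act_word_act u v w : reduced (fst u) -> reduced (fst v) ->
  act u (word (act v w)) = act (act u (word v)) w.
Proof.
  move=> hu; elim: w v => [//|a w IH] v hv /=.
  by rewrite IH ?act_word_step //; apply: step_reduced.
Qed.

Definition letter_bar (a : G + edge) : G + edge :=
  match a with inl g => inl g^-1 | inr e => inr (bar e) end.

Definition word_bar (w : list (G + edge)) := rev (map letter_bar w).

Lemma act_word_bar u w : reduced (fst u) -> act (act u (word_bar w)) w = u.
Proof.
  elim: w u => [//|a w IH] u hu; rewrite /word_bar /= act_app /=.
  set v := act u _; have hv : reduced (fst v) by apply: act_reduced.
  suff -> : step (step v (letter_bar a)) a = v by exact: IH.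
  case: a => [g|e]; first by rewrite step_mul gmulV step1.
  by rewrite -{2}(barK e) step_barK.
Qed.

(** * The group of reduced forms *)

Definition hnn_car : Type := {u : nform | reduced (fst u)}.

Lemma hnn_ext (a b : hnn_car) : proj1_sig a = proj1_sig b -> a = b.
Proof.
  by case: a b => [u hu] [v hv] /= e; subst v; rewrite (proof_irrelevance _ hu hv).
Qed.

Definition hnn_act (a : hnn_car) w : hnn_car :=
  exist _ (act (proj1_sig a) w) (act_reduced w _ (proj2_sig a)).
Definition hnn_one : hnn_car := exist _ ([], 1) Logic.I.
Definition hnn_mul (a b : hnn_car) : hnn_car := hnn_act a (word (proj1_sig b)).
Definition hnn_inv (a : hnn_car) : hnn_car :=
  hnn_act hnn_one (word_bar (word (proj1_sig a))).

Lemma hnn_mulA a b c : hnn_mul a (hnn_mul b c) = hnn_mul (hnn_mul a b) c.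
Proof. by apply: hnn_ext; apply: (act_word_act _ _ _ (proj2_sig a) (proj2_sig b)). Qed.

Lemma hnn_mul1 a : hnn_mul hnn_one a = a.
Proof. by apply: hnn_ext; apply: (act_word _ (proj2_sig a)). Qed.

Lemma hnn_mulV a : hnn_mul (hnn_inv a) a = hnn_one.
Proof. by apply: hnn_ext; apply: (act_word_bar ([], 1) _ Logic.I). Qed.

Definition hnn : Grp := {|
  car := hnn_car; gmul := hnn_mul; gone := hnn_one; ginv := hnn_inv;
  gmulA := hnn_mulA; gmul1 := hnn_mul1; gmulV := hnn_mulV |}.

(** * Length and direction in the Bass-Serre tree *)

Fixpoint bottom l : option syllable :=
  match l with
  | [] => None
  | s :: l' => match bottom l' with None => Some s | d => d end
  end.

Lemma bottom_None l : bottom l = None <-> l = [].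
Proof. by case: l => [//|s l] /=; case: (bottom l). Qed.

Lemma bottom_app l l' : l <> [] -> bottom (l' ++ l) = bottom l.
Proof.
  move=> /bottom_None; elim: l' => [//|s l' IH] h /=; rewrite IH //.
  by case: (bottom l) h.
Qed.

Lemma reduced_bottom_rep l r e : reduced l -> bottom l = Some (r, e) -> rep e r = r.
Proof.
  elim: l => [//|[r' e'] l IH] /= [hr [_ /IH hl]].
  by case: (bottom l) hl => [s h /h|_ [<- <-]].
Qed.

Definition emb (g : G) : hnn := exist _ ([], g) Logic.I.
Definition stable e : hnn :=
  exist _ (step ([], 1) (inr e)) (step_reduced ([], 1) (inr e) Logic.I).
Definition nf (h : hnn) : nform := proj1_sig h.
(** [tau] is the distance from the base vertex of the tree to its translate by [h]. As lists store
    the last syllable at the head, [dir] is the first syllable, that is, the edge at the base vertex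
    leading to that translate. *)
Definition tau (h : hnn) : nat := length (fst (nf h)).
Definition dir (h : hnn) : option syllable := bottom (fst (nf h)).
Definition gen_of (a : G + edge) : hnn :=
  match a with inl g => emb g | inr e => stable e end.
Definition syl (s : syllable) : hnn := emb (fst s) * stable (snd s).
Implicit Types (h k : hnn) (s : syllable).

Lemma nf_inj h k : nf h = nf k -> h = k.
Proof. exact: hnn_ext. Qed.

Lemma nf_reduced h : reduced (fst (nf h)).
Proof. by case: h. Qed.

Lemma nf_mul h k : nf (h * k) = act (nf h) (word (nf k)).
Proof. by []. Qed.

Lemma nf_mul_gen h a : nf (h * gen_of a) = step (nf h) a.
Proof.
  case: a => [g //|e].
  change (act (nf h) (word (step ([], 1) (inr e))) = step (nf h) (inr e)).
  rewrite (act_word_step (nf h) ([], 1) (inr e)) //; first exact: nf_reduced.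
  by congr step; apply: step1.
Qed.

Lemma nf_mul_emb h g : nf (h * emb g) = step (nf h) (inl g).
Proof. by []. Qed.

Lemma nf_mul_stable h e : nf (h * stable e) = step (nf h) (inr e).
Proof. exact: (nf_mul_gen h (inr e)). Qed.

Lemma embM g g' : emb (g * g') = emb g * emb g'.
Proof. by apply: nf_inj. Qed.

Lemma emb1 : emb 1 = 1.
Proof. by []. Qed.

Lemma embV g : emb g^-1 = (emb g)^-1.
Proof. by apply: invg_unique; rewrite -embM mulgV. Qed.

Lemma emb_inj g g' : emb g = emb g' -> g = g'.
Proof. by move=> /(f_equal nf) []. Qed.

Lemma stable_rel e a b : rel e a b -> emb a * stable e = stable e * emb b.
Proof.
  move=> hr; apply: nf_inj; rewrite nf_mul_emb nf_mul_stable.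
  by rewrite -[nf (stable e)]/(step ([], 1) (inr e)) -(step_rel e a b) //= gmul1.
Qed.

Lemma stable_bar e : stable e * stable (bar e) = 1.
Proof. by apply: nf_inj; rewrite nf_mul_stable; apply: (step_barK e ([], 1) Logic.I). Qed.

Lemma stableV e : (stable e)^-1 = stable (bar e).
Proof. by symmetry; apply/invg_unique/stable_bar. Qed.

Lemma nf_syl r e : rep e r = r -> nf (syl (r, e)) = ([(r, e)], 1).
Proof.
  move=> hr; rewrite nf_mul_stable.
  by rewrite step_push // /push hr gmulV phi1.
Qed.

Lemma dir_rep h r e : dir h = Some (r, e) -> rep e r = r.
Proof. exact: (reduced_bottom_rep _ _ _ (nf_reduced h)). Qed.

Lemma tau0 h : tau h = 0%nat <-> dir h = None.
Proof. by rewrite /tau /dir bottom_None length_zero_iff_nil. Qed.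

Lemma dir_None h : dir h = None <-> exists g, h = emb g.
Proof.
  split=> [|[g ->] //]; rewrite /dir bottom_None => e.
  by exists (snd (nf h)); apply: nf_inj; rewrite /= -e; case: (nf h).
Qed.

Lemma tau_emb g : tau (emb g) = 0%nat.
Proof. by []. Qed.

Definition act_syl g (s : syllable) : syllable := (rep (snd s) (g * fst s), snd s).

(** Beyond the junction, renormalising representatives affects no cancellation test: the carried
    element [a] lies in [dom (bar e)], the group in which the next possible cancellation is
    decided. *)
Lemma act_list_word_app l0 g0 l : reduced l ->
  (forall r e, bottom l = Some (r, e) -> ~ cancels e l0 (g0 * r)) ->
  exists l' a, act (l0, g0) (list_word l) = (l' ++ l0, a) /\
    length l' = length l /\ bottom l' = option_map (act_syl g0) (bottom l) /\
    match l, l' with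
    | (_, e) :: _, (_, e') :: _ => e' = e /\ dom (bar e) a
    | [], [] => a = g0
    | _, _ => False
    end.
Proof.
  elim: l => [|[r e] l IH] /= hl hb; first by exists [], g0.
  case: hl => [hr [hc hl]].
  have [|l' [a [h1 [h2 [h3 h4]]]]] := IH hl.
    by move=> r' e' hb'; apply: hb; rewrite hb'.
  have push' : ~ cancels e (l' ++ l0) (a * r) ->
    act (l0, g0) (list_word l ++ [inl r; inr e]) = push e (l' ++ l0) (a * r).
    by move=> nc; rewrite act_app h1; apply: step_push.
  have hd := phi_dom _ _ (rep_dom' e (a * r)).
  have nc : ~ cancels e (l' ++ l0) (a * r).
    case: l l' h4 hc {IH hl push' h1 h2 h3 hd} hb => [|[r1 e1] l] [|[r1' e1'] l'] //=.
      by move=> -> _; apply.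
    move=> [-> hda] hc _ [he]; rewrite he barK in hda.
    by rewrite (domMl e a r hda); auto.
  rewrite push' // /push.
  exists ((rep e (a * r), e) :: l'), (phi e ((rep e (a * r))^-1 * (a * r))).
  split=> //=; rewrite h2 h3; split=> //; split=> //.
  case: l l' h4 {IH hl push' h1 h2 h3 hd hc nc hb} => [|[r1 e1] l] [|[r1' e1'] l'] //=.
    by move=> ->.
  by case: (bottom l).
Qed.

Lemma mul_list h k :
  (forall r e, dir k = Some (r, e) -> ~ cancels e (fst (nf h)) (snd (nf h) * r)) ->
  exists l, fst (nf (h * k)) = l ++ fst (nf h) /\ length l = tau k /\
    bottom l = option_map (act_syl (snd (nf h))) (dir k).
Proof.
  move=> nc; have [l [a [h1 [h2 [h3 _]]]]] :=
    act_list_word_app (fst (nf h)) (snd (nf h)) _ (nf_reduced k) nc.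
  exists l; split=> //; rewrite nf_mul act_app.
  by rewrite [nf h]surjective_pairing h1.
Qed.

Lemma dir_emb_mul g h : dir (emb g * h) = option_map (act_syl g) (dir h).
Proof.
  have [|l [h1 [h2 h3]]] := mul_list (emb g) h; first by move=> ? ? _ [].
  by rewrite /dir h1 app_nil_r.
Qed.

Lemma tau_emb_mul g h : tau (emb g * h) = tau h.
Proof.
  have [|l [h1 [h2 h3]]] := mul_list (emb g) h; first by move=> ? ? _ [].
  by rewrite /tau h1 app_nil_r.
Qed.

Lemma dir_mul_emb h g : dir (h * emb g) = dir h.
Proof. by []. Qed.

(** If h = k t_e g, then h^-1 = g^-1 t_(bar e) k^-1, and reducedness of h excludes cancellation
    before k^-1: the inverse starts with the last edge of h, reversed. *)
Lemma dir_inv_aux l g (hl : reduced l) (h : hnn) : nf h = (l, g) ->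
  tau h^-1 = length l /\
  dir h^-1 = match l with [] => None
                     | (_, e) :: _ => Some (rep (bar e) g^-1, bar e) end.
Proof.
  elim: l g hl h => [|[r e] l IH] g hl h hh.
    have -> : h = emb g by apply: nf_inj.
    by rewrite -embV.
  case: (hl) => [hr [hc hl']].
  pose k : hnn := exist _ (l, r) hl'.
  have [ht hd] := IH r hl' k eq_refl.
  have e1 : h = k * stable e * emb g.
    apply: nf_inj; rewrite nf_mul_emb nf_mul_stable hh [nf k]/=.
    by rewrite step_push // /push hr gmulV phi1 /= gmul1.
  set p := emb g^-1 * stable (bar e).
  have e2 : h^-1 = p * k^-1 by rewrite e1 !invMg stableV -embV !mulgA'.
  have hp : nf p = push (bar e) [] g^-1.
    by rewrite nf_mul_stable step_push.
  have [|l' [h1 [h2 h3]]] := mul_list p k^-1.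
    rewrite hd hp /push /=; case: (l) hc => [|[r' e'] l1] //= hc ? ? [<- <-] [he].
    have hdom := phi_dom _ _ (rep_dom' (bar e) g^-1).
    rewrite barK in he; subst e'.
    rewrite (domMl _ _ _ hdom) dom_rep dom_invP barK => hdr; exact: hc.
  rewrite e2 /tau /dir h1 length_app h2 ht hp /= Nat.add_1_r; split=> //.
  by rewrite bottom_app.
Qed.

Lemma tauV h : tau h^-1 = tau h.
Proof.
  case e: (nf h) => [l g]; have hl : reduced l by have := nf_reduced h; rewrite e.
  by have [-> _] := dir_inv_aux l g hl h e; rewrite /tau e.
Qed.

Lemma dirV_eq h l r e g : nf h = ((r, e) :: l, g) ->
  dir h^-1 = Some (rep (bar e) g^-1, bar e).
Proof.
  move=> eh; have hl : reduced ((r, e) :: l) by have := nf_reduced h; rewrite eh.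
  by have [_ ->] := dir_inv_aux _ g hl h eh.
Qed.

(* No cancellation takes place in h * k as soon as the directions of h^-1 and k
   at the base vertex of the Bass-Serre tree differ. *)
Lemma mul_no_cancel h k : dir h^-1 <> dir k \/ dir k = None ->
  tau (h * k) = (tau h + tau k)%nat /\
  ((0 < tau h)%nat -> dir (h * k) = dir h).
Proof.
  move=> hk.
  have [|l [h1 [h2 h3]]] := mul_list h k.
    move=> r e hd; case: hk => [hk|]; last by rewrite hd.
    case eh: (nf h) => [[|[r' e'] l] g] //= [he hdr].
    apply: hk; rewrite (dirV_eq h l r' e' g eh) hd he barK -(dir_rep _ _ _ hd).
    by congr (Some (_, _)); apply: rep_eq; rewrite invgK.
  rewrite /tau /dir h1 length_app h2; split; first by rewrite /tau Nat.add_comm.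
  move=> h0; rewrite bottom_app // => e0; by rewrite e0 in h0; inversion h0.
Qed.

(** Translating back by the first syllable moves the base vertex one edge along the path; the last
    clause says that the remaining path does not backtrack. *)
Lemma syl_strip h s : dir h = Some s -> exists k, h = syl s * k /\
  tau h = Datatypes.S (tau k) /\ dir k <> dir (syl s)^-1.
Proof.
  move: s => [r e].
  have : forall l, bottom l = Some (r, e) -> reduced l ->
    exists l', l = l' ++ [(r, e)] /\ reduced l' /\
      bottom l' <> Some (rep (bar e) 1, bar e).
    elim=> [//|[r' e'] l IH] hb [hr [hc hl]]; case: l IH hb hr hc hl => [|s l] IH hb hr hc hl.
      by case: hb => -> ->; exists [].
    have hb' : bottom (s :: l) = Some (r, e).
      by move: hb => /=; case: (bottom l).
    have [l' [h1 [h2 h3]]] := IH hb' hl.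
    exists ((r', e') :: l'); rewrite h1; split=> //; split.
      split=> //; split=> //; move: hc; rewrite h1.
      by case: (l') => [_ []|].
    case: l' h1 h2 h3 => [|s' l'] h1 h2 h3 /=; last first.
      by move: h3 => /=; case: (bottom l').
    move=> [h4 h5]; apply: hc; rewrite h1 /= h5 barK; split=> //.
    by rewrite h4; apply/dom_rep/dom1.
  move=> H hd; have [l' [h1 [h2 h3]]] := H _ hd (nf_reduced h).
  have hr := dir_rep _ _ _ hd.
  exists (exist _ (l', snd (nf h)) h2); split; last split.
  - apply: nf_inj; rewrite nf_mul (nf_syl r e hr).
    rewrite -{1}(act_word (nf h) (nf_reduced h)) /word h1.
    have -> : list_word (l' ++ [(r, e)]) = [inl r; inr e] ++ list_word l'.
      by elim: (l') => [//|[r1 e1] l1 /= ->].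
    rewrite -app_assoc act_app; congr act.
    change (step ([], 1 * r) (inr e) = ([(r, e)], 1)).
    by rewrite gmul1 step_push // /push hr gmulV phi1.
  - by rewrite /tau h1 length_app Nat.add_1_r.
  - by rewrite (dirV_eq _ [] r e 1) ?invg1 //; apply: nf_syl.
Qed.

Lemma dir_syl r e : rep e r = r -> dir (syl (r, e)) = Some (r, e).
Proof. by move=> hr; rewrite /dir nf_syl. Qed.

Lemma dir_sylV r e : rep e r = r -> dir (syl (r, e))^-1 = Some (rep (bar e) 1, bar e).
Proof. by move=> hr; rewrite (dirV_eq _ [] r e 1) ?nf_syl ?invg1. Qed.

Lemma tau_syl r e : rep e r = r -> tau (syl (r, e)) = 1%nat.
Proof. by move=> hr; rewrite /tau nf_syl. Qed.

(** * Hyperbolicity *)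

Section Metric.
Context (S : list G) (delta : nat) (indices : list I).
Hypotheses (gen : generates G S) (hyp : four_point S delta)
  (indicesP : forall i, In i indices)
  (P_S : forall i x y, P i x y -> In x S /\ In y S).

Definition hnn_gens : list hnn :=
  map emb S ++ map (fun i => stable (i, true)) indices.

Lemma letter_emb g : letter G S g -> letter hnn hnn_gens (emb g).
Proof.
  have h x : In x S -> In (emb x) hnn_gens.
    by move=> hx; apply/in_app_iff; left; apply: in_map.
  move=> [/h|[x [/h hx ->]]]; [by left | right].
  by exists (emb x); rewrite embV.
Qed.

Lemma letter_stable e : letter hnn hnn_gens (stable e).
Proof.
  have h i : In (stable (i, true)) hnn_gens.
    by apply/in_app_iff; right; apply: in_map.
  case: e => i []; [by left | right].
  by exists (stable (i, true)); rewrite stableV.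
Qed.

Lemma letter_gen_of h : letter hnn hnn_gens h -> exists a, h = gen_of a /\
  match a with inl g => letter G S g | inr _ => True end.
Proof.
  have H k : In k hnn_gens -> exists a, k = gen_of a /\
    match a with inl g => In g S | inr _ => True end.
    move=> /in_app_iff [] /in_map_iff [y [<- hy]]; first by exists (inl y).
    by exists (inr (y, true)).
  move=> [/H|[k [/H [[g|e] [-> hg]] ->]]].
  - by move=> [[g|e] [-> hg]]; [exists (inl g); split; [|left] | exists (inr e)].
  - by exists (inl g^-1); split; [rewrite -embV | right; exists g].
  - by exists (inr (bar e)); rewrite stableV.
Qed.

Lemma represents_emb g n : represents G S g n -> represents hnn hnn_gens (emb g) n.
Proof.
  move=> [w [<- [hw <-]]]; elim: hw => {w} [|a w ha _ IH] /=.
    exact: represents1.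
  rewrite embM -Nat.add_1_l; apply: represents_mul => //.
  by apply/represents_letter/letter_emb.
Qed.

Lemma hnn_generates : generates hnn hnn_gens.
Proof.
  have hE g : exists n, represents hnn hnn_gens (emb g) n.
    by have [n hn] := gen g; exists n; apply: represents_emb.
  move=> h; have [n hn] : exists n, tau h = n by exists (tau h).
  elim: n h hn => [|n IH] h hn.
    by have /dir_None [g ->] := proj1 (tau0 h) hn.
  case hd: (dir h) => [[r e]|]; last by move/tau0: hd => hd; rewrite hd in hn.
  have [k [ek [ht _]]] := syl_strip h _ hd.
  have [|m hm] := IH k; first by lia.
  have [p hp] := hE r; exists (p + 1 + m)%nat; rewrite ek.
  apply: represents_mul => //; apply: represents_mul => //.
  exact/represents_letter/letter_stable.
Qed.

Local Notation dH := (wd hnn_gens).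

(** The ball was taken as generating set for this: the gate r [dom e] of each branch has diameter at
    most 1. *)
Lemma dom_wlen e a : dom e a -> (wlen S a <= 1)%nat.
Proof.
  move=> [b]; case: e => i [] /= /P_S [h1 h2]; apply: wlen_letter => //; by left.
Qed.

(* The nearest point retraction onto the base coset, up to distance 1. *)
Definition rho (h : hnn) : G :=
  match dir h with None => snd (nf h) | Some (r, _) => r end.

Lemma rho_emb g : rho (emb g) = g.
Proof. by []. Qed.

(** An edge of the Cayley graph leaves a branch only by entering the base copy of [G] at a point of
    the gate r [dom e]. *)
Lemma dir_step h r e a : dir h = Some (r, e) ->
  dir (h * gen_of a) = Some (r, e) \/
  exists b, dom e b /\ h * gen_of a = emb (r * b).
Proof.
  rewrite /dir nf_mul_gen; case: a => [g|e']; first by left.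
  case: (stepP (nf h) e') => [[r' [l [enf [h1 h2]]]]|[h1 h2]] hd; last first.
    by left; rewrite h2 /= hd.
  rewrite enf in hd; case: l h2 hd {enf} => [|s l] h2 hd; last first.
    by left; rewrite h2 /=; move: hd => /=; case: (bottom l).
  right; exists (phi e' (snd (nf h))); case: hd => <- <-.
  split; first exact: phi_dom.
  by apply: nf_inj; rewrite nf_mul_gen h2.
Qed.

Lemma dir_step_emb g e : dir (emb g * stable e) = Some (rep e g, e).
Proof. by rewrite /dir nf_mul_stable step_push. Qed.

Lemma rho_step h a : letter hnn hnn_gens a -> (wd S (rho h) (rho (h * a)) <= 1)%nat.
Proof.
  move=> /letter_gen_of [x [-> hx]]; case hd: (dir h) => [[r e]|].
    rewrite {1}/rho hd; case: (dir_step h r e x hd) => [h1|[b [hb ->]]].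
      by rewrite /rho h1 wdxx //; lia.
    by rewrite rho_emb /wd mulVK; apply: dom_wlen hb.
  move/dir_None: hd => [g ->]; rewrite rho_emb; case: x hx => [g'|e] hx.
    by rewrite -embM rho_emb /wd mulVK; apply: wlen_letter.
  by rewrite /rho dir_step_emb; apply: dom_wlen (rep_dom e g).
Qed.

Lemma rho_contract h k : (wd S (rho h) (rho k) <= dH h k)%nat.
Proof.
  have [w [hl [hw ew]]] := wlen_rep hnn_gens hnn_generates (h^-1 * k).
  rewrite {2}/wd -hl -{1}(mulKV h k) -ew.
  elim: hw h {ew hl} => {w k} [|a w ha _ IH] h /=; first by rewrite mulg1 wdxx.
  have := wd_triangle S gen (rho (h * a)) (rho h) (rho (h * (a * eval_word hnn w))).
  by have := IH (h * a); have := rho_step h a ha; rewrite mulgA'; lia.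
Qed.

(** The retraction [rho] is 1-Lipschitz, so excursions outside the base copy give no shortcut. *)
Lemma emb_isometric g g' : dH (emb g) (emb g') = wd S g g'.
Proof.
  apply: Nat.le_antisymm; last exact: (rho_contract (emb g) (emb g')).
  apply: wlen_le; first exact: hnn_generates.
  by rewrite -embV -embM; apply/represents_emb/wlen_rep.
Qed.

Lemma path_cut w h r e : dir h = Some (r, e) -> Forall (letter hnn hnn_gens) w ->
  dir (h * eval_word hnn w) <> Some (r, e) ->
  exists w1 w2 b, w = w1 ++ w2 /\ dom e b /\ h * eval_word hnn w1 = emb (r * b).
Proof.
  move=> + hw; elim: hw h => {w} [|a w ha _ IH] h hd /=; first by rewrite mulg1 hd.
  rewrite gmulA => hne; have [x [ex _]] := letter_gen_of a ha.
  case: (dir_step h r e x hd) => [h1|[b [hb h1]]]; rewrite -ex in h1.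
    have [w1 [w2 [b [-> [hb h2]]]]] := IH (h * a) h1 hne.
    by exists (a :: w1), w2, b; rewrite /= gmulA.
  by exists [a], w, b; rewrite /= mulg1.
Qed.

(** A geodesic between the points meets the gate at some r b; replacing r b by r costs at most 1 on
    each side. *)
Lemma dist_cut h k r e : dir h = Some (r, e) -> dir k <> Some (r, e) ->
  (dH h (emb r) + dH (emb r) k <= dH h k + 2)%nat.
Proof.
  move=> hh hk.
  have [w [hl [hw ew]]] := wlen_rep hnn_gens hnn_generates (h^-1 * k).
  have [|w1 [w2 [b [eww [hb h1]]]]] := path_cut w h r e hh hw.
    by rewrite ew mulKV.
  have le1 : (dH h (emb (r * b)) <= length w1)%nat.
    apply: wlen_le; first exact: hnn_generates.
    exists w1; rewrite -h1 mulVK; split=> //; split=> //.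
    by move: hw; rewrite eww => /Forall_app [].
  have le2 : (dH (emb (r * b)) k <= length w2)%nat.
    apply: wlen_le; first exact: hnn_generates.
    exists w2; split=> //; split; first by move: hw; rewrite eww => /Forall_app [].
    apply: (mulgI (emb (r * b))); rewrite mulKV -h1 mulgA' -eval_word_app -eww ew.
    by rewrite mulKV.
  have le3 : (dH (emb r) (emb (r * b)) <= 1)%nat.
    by rewrite emb_isometric /wd mulVK; apply: dom_wlen hb.
  have := wd_triangle _ hnn_generates (emb (r * b)) h (emb r).
  have := wd_triangle _ hnn_generates (emb (r * b)) (emb r) k.
  have : dH h k = (length w1 + length w2)%nat by rewrite /wd -hl eww length_app.
  by rewrite (wd_sym _ hnn_generates (emb (r * b)) (emb r)); lia.
Qed.

(** No common branch at the base; a point of the base copy is separated from every point. *)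
Definition separated (h k : hnn) : Prop := dir h = dir k -> dir h = None.

Lemma separated_sym h k : separated h k -> separated k h.
Proof. by move=> hk e; rewrite e; apply: hk. Qed.

Definition height (h : hnn) : nat := dH h (emb (rho h)).

Lemma dist_separated1 h k : separated h k ->
  (height h + dH (emb (rho h)) k <= dH h k + 2)%nat.
Proof.
  rewrite /height /rho => hk; case hd: (dir h) => [[r e]|].
    apply: (dist_cut _ _ _ _ hd) => e1; move: hk; rewrite /separated hd e1.
    by move/(_ eq_refl).
  move/dir_None: hd => [g ->] /=; rewrite -/(nf _) /= wdxx; first exact: hnn_generates.
  by lia.
Qed.

Lemma dist_separated h k : separated h k ->
  (height h + wd S (rho h) (rho k) + height k <= dH h k + 4)%nat.
Proof.
  move=> /dist_separated1 h1.
  have h2 : separated k (emb (rho h)) by move=> ->.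
  have := dist_separated1 _ _ h2; rewrite emb_isometric (wd_sym _ hnn_generates k).
  by rewrite (wd_sym _ gen (rho k)); lia.
Qed.

Lemma dist_le h k : (dH h k <= height h + wd S (rho h) (rho k) + height k)%nat.
Proof.
  have := wd_triangle _ hnn_generates (emb (rho h)) h k.
  have := wd_triangle _ hnn_generates (emb (rho k)) (emb (rho h)) k.
  rewrite emb_isometric (wd_sym _ hnn_generates (emb (rho k)) k) /height; lia.
Qed.

(** All three comparisons are kept, so that the points can be permuted. The 4 added to [delta] is
    the loss in [dist_separated], which counts twice in a sum of two distances. *)
Definition four_point_sums (x y z w : hnn) : Prop :=
  let A := (dH x y + dH z w)%nat in
  let B := (dH x z + dH y w)%nat in
  let C := (dH x w + dH y z)%nat in
  let K := (2 * (delta + 4))%nat in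
  (A <= Nat.max B C + K /\ B <= Nat.max A C + K /\ C <= Nat.max A B + K)%nat.

(** Up to 4, each distance is two heights plus a distance in [G], and the heights contribute the
    same total to all three sums. *)
Lemma four_point_star (x y z w : hnn) :
  separated x y -> separated x z -> separated x w ->
  separated y z -> separated y w -> separated z w -> four_point_sums x y z w.
Proof.
  move=> /dist_separated h1 /dist_separated h2 /dist_separated h3
         /dist_separated h4 /dist_separated h5 /dist_separated h6.
  have k1 := dist_le x y; have k2 := dist_le x z; have k3 := dist_le x w.
  have k4 := dist_le y z; have k5 := dist_le y w; have k6 := dist_le z w.
  have q1 := hyp (rho x) (rho y) (rho z) (rho w).
  have q2 := hyp (rho x) (rho z) (rho y) (rho w).
  have q3 := hyp (rho x) (rho w) (rho y) (rho z).
  rewrite ?(wd_sym S gen (rho w)) ?(wd_sym S gen (rho z) (rho y)) in q1 q2 q3 *.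
  by rewrite /four_point_sums; lia.
Qed.

(** Both sums pairing points across the gate equal, up to 4, the total distance of the four points
    to [c], which also bounds the third sum. *)
Lemma four_point_split (x y z w : hnn) s : dir x = Some s -> dir w = Some s ->
  dir y <> Some s -> dir z <> Some s -> four_point_sums x y z w.
Proof.
  case: s => r e hx hw hy hz; set c := emb r.
  have h1 := dist_cut _ _ _ _ hx hy; have h2 := dist_cut _ _ _ _ hx hz.
  have h3 := dist_cut _ _ _ _ hw hy; have h4 := dist_cut _ _ _ _ hw hz.
  rewrite -/c in h1 h2 h3 h4.
  have k1 := wd_triangle _ hnn_generates c x y.
  have k2 := wd_triangle _ hnn_generates c x z.
  have k3 := wd_triangle _ hnn_generates c w y.
  have k4 := wd_triangle _ hnn_generates c w z.
  have k5 := wd_triangle _ hnn_generates c x w.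
  have k6 := wd_triangle _ hnn_generates c y z.
  rewrite (wd_sym _ hnn_generates y c) (wd_sym _ hnn_generates c w) in k6 k5.
  rewrite /four_point_sums (wd_sym _ hnn_generates z w) (wd_sym _ hnn_generates y w).
  by lia.
Qed.

(** From [x], advance towards [y] as long as [y] and [z] leave in the same direction; [x] stays
    behind, in a direction that neither of them takes. *)
Lemma median (x y z : hnn) : exists m,
  separated (m^-1 * x) (m^-1 * y) /\ separated (m^-1 * x) (m^-1 * z) /\
  separated (m^-1 * y) (m^-1 * z).
Proof.
  suff H n m : tau (m^-1 * y) = n -> separated (m^-1 * x) (m^-1 * y) ->
    separated (m^-1 * x) (m^-1 * z) -> exists m,
    separated (m^-1 * x) (m^-1 * y) /\ separated (m^-1 * x) (m^-1 * z) /\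
    separated (m^-1 * y) (m^-1 * z).
    by apply: (H _ x eq_refl); rewrite gmulV.
  elim: n m => [|n IH] m hn hxy hxz.
    by exists m; split=> //; split=> //; move=> _; apply/tau0.
  case: (classic (separated (m^-1 * y) (m^-1 * z))) => [hyz|]; first by exists m.
  move=> nsep; have [eyz _] := imply_to_and _ _ nsep; 
  case hy: (dir (m^-1 * y)) => [s|]; last by case: nsep.
  have hz : dir (m^-1 * z) = Some s by rewrite -eyz.
  have [y' [ey [ty dy]]] := syl_strip _ _ hy.
  have [z' [ez [_ dz]]] := syl_strip _ _ hz.
  case: s hy hz ey ez dy dz => r e hy hz ey ez dy dz.
  have hr := dir_rep _ _ _ hy.
  have hx : dir ((syl (r, e))^-1 * (m^-1 * x)) = dir (syl (r, e))^-1.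
    apply: (proj2 (mul_no_cancel _ _ _)); last by rewrite tauV tau_syl //; lia.
    left; rewrite invgK dir_syl // => ex.
    by move: hxy; rewrite /separated -ex hy => /(_ eq_refl).
  have em k : (m * syl (r, e))^-1 * k = (syl (r, e))^-1 * (m^-1 * k).
    by rewrite invMg mulgA'.
  apply: (IH (m * syl (r, e))); rewrite /separated ?em ?hx ?ey ?ez ?mulVK.
  - by lia.
  - by move=> e1; case: dy.
  - by move=> e1; case: dz.
Qed.

Lemma hnn_four_point : four_point hnn_gens (delta + 4).
Proof.
  move=> x y z w; suff : four_point_sums x y z w by case.
  have [m [hxy [hxz hyz]]] := median x y z.
  suff : four_point_sums (m^-1 * x) (m^-1 * y) (m^-1 * z) (m^-1 * w).
    by rewrite /four_point_sums !wdL.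
  move: (m^-1 * x) (m^-1 * y) (m^-1 * z) (m^-1 * w) hxy hxz hyz => {m w}x {}y {}z w.
  move=> hxy hxz hyz.
  (* With the base at the median, the fourth point shares a branch with at most one of the other
     three. *)
  have split a b c : separated a b -> separated a c -> ~ separated a w ->
      four_point_sums a b c w.
    move=> hab hac naw; have [eaw nNone] := imply_to_and _ _ naw.
    case ha: (dir a) => [s|]; last by rewrite ha in nNone.
    apply: (four_point_split _ _ _ _ s) => //; first by rewrite -eaw.
      by move=> hb; apply: nNone; apply: hab; rewrite ha hb.
    by move=> hc; apply: nNone; apply: hac; rewrite ha hc.
  case: (classic (separated x w)) => [hxw|]; last by apply: split.
  case: (classic (separated y w)) => [hyw|/(split y x z)]; last first.
    move=> /(_ (separated_sym _ _ hxy) hyz); rewrite /four_point_sums.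
    by rewrite (wd_sym _ hnn_generates y x); lia.
  case: (classic (separated z w)) => [hzw|/(split z x y)]; last first.
    move=> /(_ (separated_sym _ _ hxz) (separated_sym _ _ hyz)).
    rewrite /four_point_sums (wd_sym _ hnn_generates z x).
    by rewrite (wd_sym _ hnn_generates z y); lia.
  exact: four_point_star.
Qed.

Lemma hnn_hyperbolic : hyperbolic hnn.
Proof.
  apply/hyperbolicP; exists hnn_gens, (delta + 4)%nat.
  by split; [exact: hnn_generates | exact: hnn_four_point].
Qed.

End Metric.

(** * Finite subgroups and centralisers *)

Lemma dom_conj g r e : rep e (g * r) = r -> dom e (r^-1 * g * r).
Proof.
  move=> hr; apply/dom_invP; have := rep_dom e (g * r).
  by rewrite hr !grpE.
Qed.

(** Elements of [K] moving the base vertex all leave in the direction of a longest one, since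
    otherwise a product in [K] would be longer. Conjugating by this common first syllable moves the
    base towards the centre of the orbit. *)
Lemma bounded_subgroup_conj_base n (K : hnn -> Prop) : subgroup hnn K ->
  (forall k, K k -> (tau k <= n)%nat) ->
  exists c, forall k, K k -> exists g, c^-1 * k * c = emb g.
Proof.
  elim: n K => [|n IH] K [K1 [KM KV]] hK.
    exists 1 => k /hK h0; rewrite !grpE; apply/dir_None/tau0; lia.
  case: (classic (exists h, K h /\ tau h = Datatypes.S n)) => [[h [Kh th]]|no]; last first.
    apply: IH => // k Kk; have := hK k Kk.
    case: (Nat.eq_dec (tau k) (Datatypes.S n)); last by lia.
    by move=> ek; case: no; exists k.
  have hdir k : K k -> (0 < tau k)%nat -> dir k = dir h.
    move=> Kk tk; apply: NNPP => ne.
    have [|e1 _] := mul_no_cancel k^-1 h; first by rewrite invgK; left.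
    by have := hK _ (KM _ _ (KV _ Kk) Kh); rewrite e1 tauV; lia.
  case hd: (dir h) => [[r e]|]; last by move/tau0: hd; lia.
  have hr := dir_rep _ _ _ hd; set s := syl (r, e).
  have [||c hc] := IH (fun x : hnn => K (s * x * s^-1)).
  - split; [|split] => [|x y Kx Ky|x Kx].
    + by rewrite !grpE.
    + by have := KM _ _ Kx Ky; rewrite !grpE.
    + by have := KV _ Kx; rewrite !grpE.
  - suff H k : K k -> (tau (s^-1 * k * s)%grp <= n)%nat.
      by move=> x /H; rewrite !grpE.
    move=> Kk; case: (Nat.eq_dec (tau k) 0) => tk.
      have [g eg] := proj1 (dir_None k) (proj1 (tau0 k) tk).
      (* Here [k] fixes the base vertex; as [k * h] is in [K], it fixes the common direction too,
         hence the next vertex. *)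
      have := hdir _ (KM _ _ Kk Kh).
      rewrite eg tau_emb_mul th dir_emb_mul hd => /(_ (Nat.lt_0_succ n)) [/= e1].
      have /phi_rel /stable_rel e2 := dom_conj _ _ _ e1.
      suff -> : s^-1 * emb g * s = emb (phi e (r^-1 * g * r)) by rewrite tau_emb; lia.
      apply: (mulgI (stable e)); rewrite -e2 !embM embV /s /syl /=.
      by rewrite !grpE.
    have hdk : dir k = Some (r, e) by rewrite -hd; apply: hdir => //; lia.
    have hdk' : dir k^-1 = Some (r, e).
      by rewrite -hd; apply: hdir; rewrite ?tauV; [apply: KV | lia].
    have [k' [ek [tk' dk']]] := syl_strip _ _ hdk.
    have ekV : k^-1 = k'^-1 * s^-1 by rewrite ek invMg.
    case: (Nat.eq_dec (tau k') 0) => tk0.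
      have [g eg] := proj1 (dir_None k') (proj1 (tau0 k') tk0).
      move: hdk'; rewrite ekV eg -embV dir_emb_mul dir_sylV //= => -[_ eb].
      by case: (bar_neq e).
    have [|_ e1] := mul_no_cancel k'^-1 s^-1; first by rewrite invgK; left.
    rewrite -ekV hdk' tauV in e1.
    have [|k'' [ek'' [tk'' _]]] := syl_strip k'^-1 (r, e); first by symmetry; apply: e1; lia.
    (* Both [k] and its inverse start with [s], so the conjugation removes a syllable at each
       end. *)
    have -> : s^-1 * k * s = k''^-1.
      by rewrite -/s in ek ek''; rewrite ek !grpE -(invgK k') ek'' !grpE.
    by have := hK k Kk; rewrite tauV; rewrite tauV in tk''; lia.
  - exists (s * c) => k Kk; have [|g hg] := hc (s^-1 * k * s); first by rewrite !grpE.
    by exists g; rewrite -hg !grpE.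
Qed.

Lemma finite_subgroup_conj_base (K : hnn -> Prop) : finite_subgroup hnn K ->
  exists c, forall k, K k -> exists g, c^-1 * k * c = emb g.
Proof.
  move=> [subK [l hl]]; apply: (bounded_subgroup_conj_base (list_max (map tau l))) => //.
  move=> k /hl hk; have /list_max_le := le_n (list_max (map tau l)).
  by rewrite Forall_map Forall_forall; apply.
Qed.

(** * The exponent sum of the stable letters *)

Definition sgn e : Z := if snd e then 1%Z else (-1)%Z.

Definition gen_exponent (a : G + edge) : Z :=
  match a with inl _ => 0%Z | inr e => sgn e end.

Fixpoint list_exponent l : Z :=
  match l with [] => 0%Z | (_, e) :: l' => (list_exponent l' + sgn e)%Z end.

Definition exponent (h : hnn) : Z := list_exponent (fst (nf h)).

Lemma list_exponent_step u a :
  list_exponent (fst (step u a)) = (list_exponent (fst u) + gen_exponent a)%Z.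
Proof.
  case: a => [g|e]; first by rewrite /= Z.add_0_r.
  case: (stepP u e) => [[r [l [eu [_ ->]]]]|[_ ->]] //.
  by rewrite eu /= /sgn /bar; case: (e) => i [] /=; lia.
Qed.

Lemma list_exponent_act u w :
  list_exponent (fst (act u w)) =
  (list_exponent (fst u) + fold_right Z.add 0 (map gen_exponent w))%Z.
Proof.
  elim: w u => [|a w IH] u /=; first by rewrite Z.add_0_r.
  by rewrite IH list_exponent_step Z.add_assoc.
Qed.

Lemma exponentM h k : exponent (h * k) = (exponent h + exponent k)%Z.
Proof.
  rewrite /exponent nf_mul list_exponent_act; congr Z.add.
  have := list_exponent_act ([], 1) (word (nf k)).
  by rewrite act_word; [exact: nf_reduced | move=> ->].
Qed.

Lemma exponent_emb g : exponent (emb g) = 0%Z.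
Proof. by []. Qed.

Lemma exponent_stable e : exponent (stable e) = sgn e.
Proof.
  rewrite -(gmul1 _ (stable e)) /exponent nf_mul_stable list_exponent_step.
  exact: Z.add_0_l.
Qed.

Lemma exponent_gpow h n : exponent (gpow hnn h n) = (Z.of_nat n * exponent h)%Z.
Proof. by elim: n => [//|n IH]; rewrite [gpow _ _ _]/= exponentM IH; lia. Qed.

Lemma exponentV h : exponent h^-1 = (- exponent h)%Z.
Proof. by have := exponentM h^-1 h; rewrite gmulV -emb1 exponent_emb; lia. Qed.

Lemma exponent_zpow h (j : Z) : exponent (zpow hnn h j) = (j * exponent h)%Z.
Proof.
  rewrite /zpow; case: (Z.leb_spec 0 j) => hj; 
    rewrite ?exponentV exponent_gpow Z2Nat.id; lia.
Qed.

Lemma dir_stable e : dir (stable e) = Some (rep e 1, e).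
Proof. by rewrite -(gmul1 _ (stable e)) -emb1 dir_step_emb. Qed.

Lemma tau_stable e : tau (stable e) = 1%nat.
Proof.
  by rewrite -(gmul1 _ (stable e)) -emb1 /tau nf_mul_stable step_push.
Qed.

Lemma dir_gpow_stable e n : n <> O -> dir (gpow hnn (stable e) n) = Some (rep e 1, e).
Proof.
  elim: n => [//|n IH] _ /=; case: (Nat.eq_dec n 0) => n0.
    by rewrite n0 /= mulg1 dir_stable.
  have [|_ ->] := mul_no_cancel (stable e) (gpow hnn (stable e) n).
  - by left; rewrite stableV dir_stable IH // => -[_ /bar_neq].
  - by rewrite tau_stable; lia.
  - by rewrite dir_stable.
Qed.

(** The first syllable is t_e only up to [rep e 1], an element of [dom e] that is moved across
    t_e. *)
Lemma stable_strip h e : dir h = dir (stable e) -> exists k,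
  h = stable e * k /\ tau h = Datatypes.S (tau k).
Proof.
  rewrite dir_stable => hd; have [k [-> [ht _]]] := syl_strip _ _ hd.
  have [b hb] : dom e (rep e 1) by apply/dom_rep/dom1.
  exists (emb b * k); rewrite tau_emb_mul ht; split=> //.
  by rewrite /syl /= (stable_rel _ _ _ hb) mulgA'.
Qed.

Lemma stable_infinite_order e : infinite_order hnn (stable e).
Proof.
  move=> n n0 /(f_equal exponent); rewrite exponent_gpow exponent_stable.
  by rewrite -emb1 exponent_emb; move: (e) => [i []] /=; rewrite /sgn /=; lia.
Qed.

(** * Elementary closure of a stable letter commuting with its edge group *)

Section CentralEdge.
Context (e : edge) (l : list G).
Hypotheses (e_id : forall x y, rel e x y -> y = x) (e_fin : forall x, dom e x -> In x l).

Local Notation t := (stable e).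
Definition edge_group (h : hnn) : Prop := exists a, dom e a /\ h = emb a.

Lemma edge_group_comm h : edge_group h -> comm h t.
Proof.
  move=> [a [[b hb] ->]]; rewrite /comm (stable_rel _ _ _ hb).
  by rewrite (e_id _ _ hb).
Qed.

Lemma edge_group_subgroup : subgroup hnn edge_group.
Proof.
  split; first by exists 1; split; first exact: dom1.
  split=> [_ _ [a [ha ->]] [b [hb ->]]|_ [a [ha ->]]].
    by exists (a * b); rewrite embM; split; first exact: domM.
  by exists a^-1; rewrite embV; split; first exact: domV.
Qed.

Lemma edge_group_finite : finite_subgroup hnn edge_group.
Proof.
  split; first exact: edge_group_subgroup.
  apply: (finite_subset _ (map emb l)) => _ [a [/e_fin ha ->]].
  exact: in_map.
Qed.

Lemma cyc_times_subgroup : subgroup hnn (cyc_times hnn t edge_group).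
Proof.
  have [F1 [FM FV]] := edge_group_subgroup.
  split; first by exists 0%Z, 1; rewrite mulg1.
  split=> [_ _ [k [f [hf ->]]] [m [f' [hf' ->]]]|_ [k [f [hf ->]]]].
    exists (k + m)%Z, (f * f'); split; first exact: FM.
    rewrite zpow_add !mulgA' -(mulgA' f) (comm_zpow _ _ m (edge_group_comm _ hf)).
    by rewrite mulgA'.
  exists (- k)%Z, f^-1; split; first exact: FV.
  rewrite invMg -zpowV; apply: comm_zpow.
  exact/edge_group_comm/FV.
Qed.

(* Conjugating by powers of t, the directions of t^n h and h t^n (or of their
   t^-n analogues) agree, so h starts with t or t^-1 unless it lies in the base. *)
Lemma centraliser_stable_gpow n h : n <> O -> comm (gpow hnn t n) h ->
  cyc_times hnn t edge_group h.
Proof.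
  move=> n0; have [m hm] : exists m, tau h = m by exists (tau h).
  have [_ [CM _]] := cyc_times_subgroup.
  have Ct (j : Z) : cyc_times hnn t edge_group (zpow hnn t j).
    exists j, 1; rewrite mulg1; split=> //; exact: (proj1 edge_group_subgroup).
  elim: m h hm => [|m IH] h hm hc.
    have [g eg] := proj1 (dir_None h) (proj1 (tau0 h) hm).
    have := f_equal dir hc; rewrite eg dir_mul_emb dir_emb_mul dir_gpow_stable //=.
    rewrite /act_syl /= rep_mull_rep mulg1 => -[/rep_eqP]; rewrite invg1 gmul1 => hg.
    by exists 0%Z, (emb g); rewrite gmul1; split=> //; exists g.
  case: (classic (dir h = dir t)) => [/stable_strip [k [ek tk]]|h1].
    have -> : h = zpow hnn t 1 * k by rewrite zpow1.
    apply: CM => //; apply: IH; first lia.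
    have -> : k = t^-1 * h by rewrite ek mulVK.
    by apply: commM => //; apply/commV/comm_sym/comm_gpow.
  case: (classic (dir h = dir t^-1)) => [|h2].
    rewrite stableV => /stable_strip [k [ek tk]].
    have -> : h = zpow hnn t (-1) * k by rewrite (zpowV _ 1) zpow1 stableV.
    apply: CM => //; apply: IH; first lia.
    have -> : k = t * h by rewrite ek -stableV mulKV.
    by apply: commM => //; apply/comm_sym/comm_gpow.
  have tpos : (0 < tau h)%nat by lia.
  have dT : dir (gpow hnn t n) = dir t by rewrite dir_gpow_stable ?dir_stable.
  have dTV : dir (gpow hnn t n)^-1 = dir t^-1.
    by rewrite -gpowV stableV dir_gpow_stable ?dir_stable.
  (* Otherwise neither h T nor T h cancels, and these equal elements would start like h and like T.
     Taking T = t^n and T = t^-n gives two values for the direction of h^-1. *)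
  have key T : dir T <> dir h -> dir T^-1 <> dir h -> (0 < tau T)%nat -> comm T h ->
      dir h^-1 = dir T.
    move=> d1 d2 tT cT; apply: NNPP => d3.
    have [|_ e1] := mul_no_cancel h T; first by left.
    have [|_ e2] := mul_no_cancel T h; first by left.
    by apply: d1; rewrite -e1 // -cT e2.
  have tT : (0 < tau (gpow hnn t n))%nat.
    case: (Nat.eq_dec (tau (gpow hnn t n)) 0) => [/tau0|]; last lia.
    by rewrite dT dir_stable.
  have e1 : dir h^-1 = dir t.
    by rewrite -dT; apply: key; rewrite ?dT ?dTV //; apply: not_eq_sym.
  have e2 : dir h^-1 = dir t^-1.
    rewrite -dTV; apply: key; rewrite ?invgK ?dT ?dTV ?tauV //; try exact: not_eq_sym.
    exact/comm_sym/commV/comm_sym.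
  by move: e1; rewrite e2 stableV !dir_stable => -[_ /bar_neq].
Qed.

(** For maximality, let k lie in a larger virtually abelian subgroup. Some t^n commutes with k t^n
    k^-1, which is therefore t^m f; the exponent sum gives m = n, and raising to the order of f
    shows that k centralises a power of t. *)
Lemma M_is_direct_stable : M_is_direct hnn t edge_group.
Proof.
  have [F1 [FM FV]] := edge_group_subgroup.
  have sgn0 : sgn e <> 0%Z by rewrite /sgn; case: (snd e).
  split; first by move=> f hf; symmetry; apply: edge_group_comm.
  split.
    move=> k [a [_ /(f_equal exponent)]]; rewrite exponent_zpow exponent_stable.
    by rewrite exponent_emb => /Z.mul_eq_0 [->|//].
  split; [|split].
  - split; first exact: cyc_times_subgroup.
    exists (fun h => exists j : Z, h = zpow hnn t j); split.
      split; first by exists 0%Z.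
      split=> [_ _ [k ->] [m ->]|_ [k ->]].
        by exists (k + m)%Z; rewrite zpow_add.
      by exists (- k)%Z; rewrite zpowV.
    split; first by move=> _ [k ->]; exists k, 1; rewrite mulg1.
    split; first by move=> _ _ [k ->] [m ->]; rewrite -!zpow_add Z.add_comm.
    have [_ [reps hreps]] := edge_group_finite; exists reps; split.
      by move=> r /hreps hr; exists 0%Z, r; rewrite gmul1.
    move=> _ [k [f [hf ->]]]; exists f, (zpow hnn t k); split; first exact/hreps.
    split; first by exists k.
    by symmetry; apply: comm_zpow; apply: edge_group_comm.
  - by exists 1%Z, 1; rewrite zpow1 mulg1.
  - move=> K vK sub k Kk.
    have Kt : K t by apply: sub; exists 1%Z, 1; rewrite zpow1 mulg1.
    have [n [n0 hn]] := virtually_abelian_power_comm K t k vK Kt Kk.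
    have [m [f [hf em]]] := centraliser_stable_gpow n _ n0 hn.
    have enm : m = Z.of_nat n.
      have := f_equal exponent em.
      rewrite !exponentM exponentV exponent_gpow exponent_zpow exponent_stable.
      by case: hf => a [_ ->]; rewrite exponent_emb; nia.
    have [o [o0 fo]] := finite_subgroup_torsion _ f edge_group_finite hf.
    apply: (centraliser_stable_gpow (n * o)); first lia.
    have cft : comm (gpow hnn t n) f by apply/comm_sym/comm_gpow/edge_group_comm.
    have := gpow_conj k (gpow hnn t n) o.
    rewrite em enm zpow_nat gpow_commM // fo mulg1 -gpow_mul => e1.
    by rewrite /comm {1}e1 !grpE.
Qed.

End CentralEdge.

(** If the sets agreed, the exponent sum would force u^d t = t u^d f with d = m - n > 0, whose two
    sides start with different stable letters. *)
Lemma stable_gpow_conj_distinct e e' m n : fst e' <> fst e ->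
  (forall f, edge_group e f -> comm f (stable e')) -> m <> n ->
  let g (i : nat) := gpow hnn (stable e') i * stable e * (gpow hnn (stable e') i)^-1 in
  ~ same_set hnn (cyc_times hnn (g m) (edge_group e)) (cyc_times hnn (g n) (edge_group e)).
Proof.
  move=> ne cf ne_mn g.
  wlog lt : m n ne_mn / (n < m)%nat => [H|].
    case: (Nat.lt_trichotomy m n) => [lt|[//|lt]]; last exact: H.
    by move=> ss; apply: (H n m) => // [|x]; [lia | symmetry; apply: ss].
  move=> /(_ (g m)) [+ _]; case.
    by exists 1%Z, 1; rewrite zpow1 mulg1; split=> //; apply: (proj1 (edge_group_subgroup e)).
  move=> k [f [hf]]; rewrite /g zpow_conj => eq.
  set u := stable e' in eq *; set t := stable e in eq *.
  have sgn0 : sgn e <> 0%Z by rewrite /sgn; case: (snd e).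
  have k1 : k = 1%Z.
    have := f_equal exponent eq; case: (hf) => a [_ ->].
    rewrite !exponentM !exponentV exponent_zpow exponent_emb !exponent_stable.
    by nia.
  have [d [d0 ed]] : exists d, d <> O /\ m = (n + d)%nat by exists (m - n)%nat; lia.
  have cfu := comm_gpow _ _ d (cf f hf).
  have cfun := commV _ _ (comm_gpow _ _ n (cf f hf)).
  have eq2 : gpow hnn u d * t = t * gpow hnn u d * f.
    rewrite k1 zpow1 ed gpow_add !mulgA' -cfun invMg in eq.
    move: eq; rewrite !mulgA' => /mulgI eq.
    apply: (mulIg (gpow hnn u d)^-1); apply: (mulIg (gpow hnn u n)^-1).
    by rewrite !mulgA' eq (gmulA _ (gpow hnn u d) f) -cfu !grpE.
  have h1 : dir (gpow hnn u d * t) = dir u.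
    have [|_ ->] := mul_no_cancel (gpow hnn u d) t.
      left; rewrite -gpowV stableV dir_gpow_stable // dir_stable => -[_ e1].
      by case: ne; rewrite -e1.
      suff : tau (gpow hnn u d) <> 0%nat by lia.
      by move=> /tau0; rewrite dir_gpow_stable.
    by rewrite /u dir_gpow_stable ?dir_stable.
  have h2 : dir (t * gpow hnn u d) = dir t.
    have [|_ ->] := mul_no_cancel t (gpow hnn u d) => //.
      left; rewrite stableV dir_gpow_stable // dir_stable => -[_ e1].
      by case: ne; rewrite -e1.
    by rewrite tau_stable; lia.
  case: hf => a [_ ef]; move: h1; rewrite eq2 ef dir_mul_emb h2 !dir_stable.
  by move=> -[_ e1]; case: ne; rewrite e1.
Qed.

End HNN.

(** * Saturation *)

(** By extensionality a finite list has finitely many subsets; applied to pairs in [S], this bounds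
    the number of stable letters. *)
Lemma finite_predicates {T : Type} (l : list T) :
  exists L : list (T -> Prop), forall A : T -> Prop, (forall x, A x -> In x l) -> In A L.
Proof.
  elim: l => [|a l [L hL]].
    exists [fun _ => False] => A hA; left; apply: functional_extensionality => x.
    by apply: propositional_extensionality; split=> // /hA.
  exists (L ++ map (fun B x => x = a \/ B x) L) => A hA; apply/in_app_iff.
  case: (classic (A a)) => ha; [right | left].
    apply/in_map_iff; exists (fun x => A x /\ x <> a); split.
      apply: functional_extensionality => x; apply: propositional_extensionality.
      split=> [[->|[]//]|hx]; first by [].
      by case: (classic (x = a)); [left | right].
    by apply: hL => x [/hA [<-|//] h]; case: h.
  by apply: hL => x hx; case: (hA x hx) => // ex; case: ha; rewrite ex.
Qed.

Lemma finite_sig {T : Type} (Q : T -> Prop) (L : list T) :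
  (forall x, Q x -> In x L) -> exists L' : list {x | Q x}, forall y, In y L'.
Proof.
  move=> hQ; exists (flat_map (fun x =>
    match excluded_middle_informative (Q x) with
    | left h => [exist Q x h] | right _ => [] end) L).
  move=> [x hx]; apply/in_flat_map; exists x; split; first exact: hQ.
  case: excluded_middle_informative => // h; left.
  by rewrite (proof_irrelevance _ h hx).
Qed.

Section Saturation.
Context {G : Grp} (S : list G).
Hypothesis (S_conj : forall F, finite_subgroup G F ->
  exists c, forall h, F h -> In (c^-1 * h * c) S).

Definition small_iso (A : G * G -> Prop) : Prop :=
  partial_iso (fun x y => A (x, y)) /\ forall p, A p -> In p (list_prod S S).

(* Every partial isomorphism is used for two stable letters, so that the group
   contains elements t and u with the same associated subgroup. *)
Definition saturation_index : Type := {A | small_iso A} * bool.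

Definition saturation_rel (i : saturation_index) (x y : G) : Prop :=
  proj1_sig (fst i) (x, y).

Lemma saturation_iso i : partial_iso (saturation_rel i).
Proof. exact: (proj1 (proj2_sig (fst i))). Qed.

Lemma saturation_rel_S i x y : saturation_rel i x y -> In x S /\ In y S.
Proof. by move=> /(proj2 (proj2_sig (fst i))) /in_prod_iff. Qed.

Lemma saturation_index_finite : exists l : list saturation_index, forall i, In i l.
Proof.
  have [L hL] := finite_predicates (list_prod S S).
  have [L' hL'] := finite_sig small_iso L (fun A hA => hL A (proj2 hA)).
  exists (list_prod L' [true; false]) => -[A b]; apply/in_prod_iff; split=> //.
  by case: b; [left | right; left].
Qed.

Definition saturation : Grp := hnn saturation_rel saturation_iso.

Local Notation emb := (emb saturation_rel saturation_iso).
Local Notation stable := (stable saturation_rel saturation_iso).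

Lemma finite_subgroup_conj_S (F : saturation -> Prop) : finite_subgroup saturation F ->
  exists c, forall x, F x -> exists r, In r S /\ c^-1 * x * c = emb r.
Proof.
  move=> finF; have [c hc] := finite_subgroup_conj_base _ _ F finF.
  case: finF => -[F1 [FM FV]] [l hl].
  pose K g := F (c * emb g * c^-1).
  have subK : subgroup G K.
    split; first by rewrite /K emb1 mulg1 mulgV.
    split=> [x y hx hy|x hx]; first by have := FM _ _ hx hy; rewrite /K embM !grpE.
    by have := FV _ hx; rewrite /K embV !grpE.
  have [|c' hc'] := S_conj K.
    split=> //.
    apply: (finite_subset _ (map (fun x => snd (nf _ _ (c^-1 * x * c))) l)) => g Kg.
    apply/in_map_iff; exists (c * emb g * c^-1); split; last exact/hl.
    by rewrite !grpE.
  exists (c * emb c') => x Fx; have [g hg] := hc x Fx.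
  exists (c'^-1 * g * c'); split.
    by apply: hc'; rewrite /K -hg !grpE.
  by rewrite !embM embV -hg !grpE.
Qed.

Lemma saturation_rel_exists (A : G -> G -> Prop) : partial_iso A ->
  (forall x y, A x y -> In x S /\ In y S) ->
  exists j : {A | small_iso A}, forall b x y, saturation_rel (j, b) x y <-> A x y.
Proof.
  move=> isoA A_S; have h : small_iso (fun p => A (fst p) (snd p)).
    by split=> // -[x y] /A_S hxy; apply/in_prod_iff.
  by exists (exist _ _ h).
Qed.

Lemma in_S_of_conj (F : saturation -> Prop) c g :
  (forall x, F x -> exists r, In r S /\ c^-1 * x * c = emb r) ->
  F (c * emb g * c^-1) -> In g S.
Proof.
  by move=> hc /hc [r [hr]]; rewrite !grpE => /emb_inj ->.
Qed.

Lemma saturation_conjugates F1 F2 (alpha : saturation -> saturation) :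
  finite_subgroup saturation F1 -> finite_subgroup saturation F2 ->
  (forall x, F1 x -> F2 (alpha x)) ->
  (forall x y, F1 x -> F1 y -> alpha (x * y) = alpha x * alpha y) ->
  (forall x y, F1 x -> F1 y -> alpha x = alpha y -> x = y) ->
  exists g : saturation, forall x, F1 x -> g * x * g^-1 = alpha x.
Proof.
  move=> fin1 fin2 a12 aM aI.
  have [c1 h1] := finite_subgroup_conj_S _ fin1.
  have [c2 h2] := finite_subgroup_conj_S _ fin2.
  have [[F1_1 [F1M F1V]] _] := fin1.
  have alpha1 : alpha 1 = 1.
    by apply: (mulgI (alpha 1)); rewrite -aM // gmul1 mulg1.
  have alphaV x : F1 x -> alpha x^-1 = (alpha x)^-1.
    by move=> hx; apply: invg_unique; rewrite -aM ?mulgV //; apply: F1V.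
  (* This is [alpha] read inside [S] through the two conjugations. *)
  pose A x y := F1 (c1 * emb x * c1^-1) /\
    alpha (c1 * emb x * c1^-1) = c2 * emb y * c2^-1.
  have isoA : partial_iso A.
  { split.
    - by rewrite /A !emb1 !mulg1 !mulgV.
    - move=> x y x' y' [hx ex] [hy ey].
      have e : c1 * emb (x * y) * c1^-1 = (c1 * emb x * c1^-1) * (c1 * emb y * c1^-1).
        by rewrite embM !grpE.
      rewrite /A e; split; first exact: F1M.
      by rewrite aM // ex ey embM !grpE.
    - move=> x x' [hx ex].
      have e : c1 * emb x^-1 * c1^-1 = (c1 * emb x * c1^-1)^-1 by rewrite embV !grpE.
      rewrite /A e; split; first exact: F1V.
      by rewrite alphaV // ex embV !grpE.
    - move=> y [_]; rewrite emb1 mulg1 mulgV alpha1 => e; apply: (emb_inj saturation_rel saturation_iso).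
      by apply: (mulgI c2); apply: (mulIg c2^-1); rewrite -e emb1 mulg1 mulgV.
    - move=> x [hx]; rewrite emb1 mulg1 mulgV -alpha1 => /(aI _ _ hx F1_1) e.
      by apply: (emb_inj saturation_rel saturation_iso); apply: (mulgI c1); apply: (mulIg c1^-1); rewrite e emb1 mulg1 mulgV. }
  have A_S x y : A x y -> In x S /\ In y S.
    move=> [hx hy]; split; first exact: in_S_of_conj h1 hx.
    by apply: (in_S_of_conj _ _ _ h2); rewrite -hy; apply: a12.
  have [j hj] := saturation_rel_exists A isoA A_S.
  pose t := stable ((j, true), true).
  exists (c2 * t^-1 * c1^-1) => x Fx.
  have [r [_ er]] := h1 x Fx; have [r' [_ er']] := h2 _ (a12 x Fx).
  have ex : x = c1 * emb r * c1^-1 by rewrite -er !grpE.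
  have ex' : alpha x = c2 * emb r' * c2^-1 by rewrite -er' !grpE.
  have hA : A r r' by rewrite /A -ex.
  have ht : emb r * t = t * emb r' by apply: stable_rel; apply/hj.
  rewrite ex' ex; apply: (mulgI c2^-1); apply: (mulIg c2).
  have -> : emb r' = t^-1 * (emb r * t) by rewrite ht !grpE.
  by rewrite !grpE.
Qed.

Lemma saturation_direct (F : saturation -> Prop) : finite_subgroup saturation F ->
  exists gs : nat -> saturation,
    (forall n, infinite_order saturation (gs n)) /\
    (forall n, M_is_direct saturation (gs n) F) /\
    (forall n m, n <> m ->
       ~ same_set saturation (cyc_times saturation (gs n) F) (cyc_times saturation (gs m) F)).
Proof.
  move=> finF; have [c hc] := finite_subgroup_conj_S _ finF.
  have [[F1 [FM FV]] _] := finF.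
  (* The identity of the conjugate of [F] lying in [S]; its two stable letters provide t and u. *)
  pose A x y := F (c * emb x * c^-1) /\ y = x.
  have isoA : partial_iso A.
  { split.
    - by rewrite /A emb1 mulg1 mulgV.
    - move=> x y x' y' [hx ->] [hy ->]; split=> //.
      by have := FM _ _ hx hy; rewrite embM !grpE.
    - by move=> x x' [hx ->]; split=> //; have := FV _ hx; rewrite embV !grpE.
    - by move=> y [].
    - by move=> x [_ ->]. }
  have A_S x y : A x y -> In x S /\ In y S.
    by move=> [hx ->]; have := in_S_of_conj _ _ _ hc hx.
  have [j hj] := saturation_rel_exists A isoA A_S.
  pose e (b : bool) : @edge saturation_index := ((j, b), true).
  pose t := stable (e true); pose u := stable (e false).
  pose E := edge_group saturation_rel saturation_iso (e true).
  have dom_e b x : dom saturation_rel (e b) x <-> F (c * emb x * c^-1).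
    split; first by move=> [y /hj []].
    by move=> h; exists x; apply/hj.
  have FE : F = conj_set c E.
    apply: functional_extensionality => x; apply: propositional_extensionality.
    split=> [Fx|[a [/dom_e h e1]]].
      have [r [_ er]] := hc x Fx; exists r; split=> //; apply/dom_e.
      by rewrite -er !grpE.
    by move: h; rewrite -e1 !grpE.
  have Eu f : E f -> comm f u.
    move=> [a [/dom_e h ->]]; apply: stable_rel; apply/hj.
    by [].
  have Eid x y : rel saturation_rel (e true) x y -> y = x by move=> /hj [].
  have Efin x : dom saturation_rel (e true) x -> In x S.
    by move=> /dom_e; apply: in_S_of_conj hc.
  have dirE := M_is_direct_stable _ saturation_iso (e true) S Eid Efin.
  pose g n := gpow saturation u n * t * (gpow saturation u n)^-1.
  (* Since [u] centralises [E], conjugating by its powers changes the cyclic factor and keeps the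
     finite one. *)
  have EE n : E = conj_set (gpow saturation u n) E.
    apply: functional_extensionality => x; apply: propositional_extensionality.
    have H f m : E f -> (gpow saturation u m)^-1 * f * gpow saturation u m = f.
      by move=> /Eu /(comm_gpow _ _ m) h; rewrite mulgA' h mulVK.
    split=> [Ex|]; rewrite /conj_set; first by rewrite H.
    move=> h; have := comm_gpow _ _ n (Eu _ h); rewrite /comm => e1.
    have ex : x = gpow saturation u n * ((gpow saturation u n)^-1 * x * gpow saturation u n) *
      (gpow saturation u n)^-1 by rewrite !grpE.
    rewrite ex; move: h e1; set y := (_ * x * _) => Ey <-.
    by rewrite mulgA' mulgV mulg1.
  exists (fun n => c * g n * c^-1); split; [|split].
  - move=> n k k0; rewrite !gpow_conj => h; apply: (stable_infinite_order _ saturation_iso (e true) k k0).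
    apply: (mulgI (c * gpow saturation u n)).
    apply: (mulIg ((c * gpow saturation u n)^-1)).
    by move: h; rewrite !grpE.
  - move=> n; rewrite FE; apply: M_is_direct_conj; rewrite (EE n).
    exact: (M_is_direct_conj _ _ _ dirE).
  - move=> n m nm ss.
    have ne : fst (e false) <> fst (e true) by [].
    apply: (stable_gpow_conj_distinct _ saturation_iso (e true) (e false) n m ne Eu nm) => x.
    have h := ss (c * x * c^-1); rewrite FE !cyc_times_conj /conj_set !grpE in h.
    exact: h.
Qed.

Lemma saturation_torsion_saturated : torsion_saturated saturation.
Proof.
  split; last exact: saturation_direct.
  move=> F1 F2 alpha fin1 fin2 a12 aM aI _.
  exact: (saturation_conjugates F1 F2).
Qed.

End Saturation.

Theorem theorem4p2 : forall G : Grp, hyperbolic G ->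
  exists H : Grp, hyperbolic H /\ torsion_saturated H /\ embeds G H.
Proof.
  move=> G /hyperbolic_saturating_generators [S [delta [gen [hyp [S1 S_conj]]]]].
  have [l hl] := saturation_index_finite S.
  exists (saturation S); split; last split.
  - apply: (hnn_hyperbolic _ _ S delta l) => // i x y; exact: saturation_rel_S.
  - exact: saturation_torsion_saturated.
  - exists (emb _ _); split; [exact: embM | exact: emb_inj].
Qed.
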